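(* Let $n\ge1$, $M>0$ and $\Delta t>0$ be given. Let $\mathcal{Q}$ be the family of fading memory functionals on $K_M$ induced by harmonic-network Gaussian reservoir systems with interaction time $\Delta t$ and $\rho(\mathbf{A})<1$, and let $\mathcal{Q}_{\text{thermal}},\mathcal{Q}_{\text{squeezed}},\mathcal{Q}_{\text{phase}}\subset\mathcal{Q}$ be the subfamilies corresponding to thermal, squeezed and phase encoding (all as defined in the context). For each $\mathcal{F}\in\{\mathcal{Q},\mathcal{Q}_{\text{thermal}},\mathcal{Q}_{\text{squeezed}},\mathcal{Q}_{\text{phase}}\}$, let $\mathcal{A}(\mathcal{F})$ be the polynomial algebra of functionals generated by $\mathcal{F}$, i.e. the set of all real polynomials in finitely many elements of $\mathcal{F}$ with pointwise operations. Then: 1. (Separability) for all $\mathbf{s},\mathbf{s}'\in K_M$ with $\mathbf{s}\ne\mathbf{s}'$ there is $G\in\mathcal{A}(\mathcal{F})$ with $G(\mathbf{s})\neq G(\mathbf{s}')$; 2. (Universality) for every functional $F:K_M\to\mathbb{R}$ with the fading memory property (equivalently, every causal, time-invariant fading memory map) and every $\varepsilon>0$ there is $G\in\mathcal{A}(\mathcal{F})$ with $\sup_{\mathbf{s}\in K_M}|F(\mathbf{s})-G(\mathbf{s})|<\varepsilon$.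
   Context: **Inputs.** For $n\ge1$, $M>0$ let $K_M=\{\mathbf{s}=(\ldots,\mathbf{s}_{-2},\mathbf{s}_{-1},\mathbf{s}_0): \mathbf{s}_k\in\mathbb{R}^n,\ \lVert\mathbf{s}_k\rVert\le M \text{ for all } k\le 0\}$ be the set of left-infinite sequences uniformly bounded by $M$. A causal, time-invariant map $U$ from input sequences to real sequences is identified with the functional $F$ such that $(U[\mathbf{s}])_t=F(\ldots,\mathbf{s}_{t-2},\mathbf{s}_{t-1},\mathbf{s}_t)$ for all $t$. **Network.** There are $N\ge2$ oscillators with frequencies $\omega_1,\ldots,\omega_N>0$ and symmetric interaction strengths $g_{ij}=g_{ji}\ge0$, $g_{ii}=0$. Let $\mathbf{L}_{ij}=\delta_{ij}\sum_k g_{ik}-(1-\delta_{ij})g_{ij}$ and $\mathbf{K}=\mathrm{diag}(\omega_1^2,\ldots,\omega_N^2)+\mathbf{L}$. The Hamiltonian is $H=\frac12\mathbf{p}^\top\mathbf{p}+\frac12\mathbf{q}^\top\mathbf{K}\mathbf{q}$ (with $\hbar=1$). Order the operators as $\mathbf{x}^\top=(q_1,p_1,q_2,p_2,\ldots,q_N,p_N)$. The symplectic matrix $\mathbf{S}(\Delta t)\in \mathrm{Sp}(2N,\mathbb{R})$ is the linear flow at time $\Delta t$ of $\dot{\mathbf{q}}=\mathbf{p}$, $\dot{\mathbf{p}}=-\mathbf{K}\mathbf{q}$, written in this ordering. Oscillator $N$ is the ancilla; oscillators $1,\ldots,N-1$ form the reservoir. Write $$\mathbf{S}(\Delta t)=\begin{pmatrix}\mathbf{A}&\mathbf{B}\\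 \mathbf{C}&\mathbf{D}\end{pmatrix},$$ with $\mathbf{A}$ of size $2(N-1)\times2(N-1)$ and $\mathbf{D}$ of size $2\times2$; $\rho(\mathbf{A})$ is the spectral radius of $\mathbf{A}$. **Encoding.** At each step $k$ the ancilla is reset to a single-mode Gaussian state with parameters $n_{th}\ge0$, $r\in\mathbb{R}$, $\varphi\in\mathbb{R}$, $|\alpha|\ge0$, $\arg(\alpha)\in\mathbb{R}$, each a continuous function of $\mathbf{s}_k$. With $\Omega=\omega_N$ its covariance matrix and first moments are $$\sigma(\mathbf{x}^A_k)=(n_{th}+\tfrac12)\begin{pmatrix}(\cosh 2r+\cos\varphi\,\sinh 2r)\,\Omega^{-1}&\sin\varphi\,\sinh 2r\\ \sin\varphi\,\sinh 2r&(\cosh 2r-\cos\varphi\,\sinh 2r)\,\Omega\end{pmatrix},\qquad \langle\mathbf{x}^A_k\rangle=\begin{pmatrix}|\alpha|\cos(\arg\alpha)\sqrt{2\Omega^{-1}}\\ |\alpha|\sin(\arg\alpha)\sqrt{2\Omega}\end{pmatrix}.$$ **Reservoir system.** The reservoir dynamics is $\mathbf{x}^R_k=\mathbf{A}\mathbf{x}^R_{k-1}+\mathbf{B}\mathbf{x}^A_k$, with the fresh ancilla uncorrelated with the reservoir, i.e. $$\langle\mathbf{x}^R_k\rangle=\mathbf{A}\langle\mathbf{x}^R_{k-1}\rangle+\mathbf{B}\langle\mathbf{x}^A_k\rangle,\qquad \sigma(\mathbf{x}^R_k)=\mathbf{A}\,\sigma(\mathbf{x}^R_{k-1})\mathbf{A}^\top+\mathbf{B}\,\sigma(\mathbf{x}^A_k)\mathbf{B}^\top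 .$$ The output is $o_k=h(\mathbf{x}^R_k)$, where $h$ is a real polynomial in the elements of $\sigma(\mathbf{x}^R_k)$ or a real polynomial in the elements of $\langle\mathbf{x}^R_k\rangle$. When $\rho(\mathbf{A})<1$, the state at step $0$ in the limit of infinitely many past inputs is independent of the initial state and equals $$\langle\mathbf{x}^R_0\rangle=\sum_{j\ge0}\mathbf{A}^j\mathbf{B}\langle\mathbf{x}^A_{-j}\rangle,\qquad \sigma(\mathbf{x}^R_0)=\sum_{j\ge0}\mathbf{A}^j\mathbf{B}\,\sigma(\mathbf{x}^A_{-j})\mathbf{B}^\top(\mathbf{A}^\top)^j ,$$ and the functional induced by the system is $K_M\to\mathbb{R}$, $\mathbf{s}\mapsto o_0=h(\mathbf{x}^R_0)$. **Fading memory property.** A null sequence is a decreasing sequence $w:\mathbb{N}_0\to(0,1]$ with $\lim_{k\to\infty}w_k=0$. A functional $F:K_M\to\mathbb{R}$ has the fading memory property if there is a null sequence $w$ such that $F$ is continuous on $K_M$ with respect to the metric induced by $\lVert\mathbf{s}\rVert_w=\sup_{k\ge0}w_k\lVert\mathbf{s}_{-k}\rVert$. **Families.** $\mathcal{Q}$ is the set of all functionals induced by such systems with the given $\Delta t$, over all $N\ge2$, frequencies and interaction strengths with $\rho(\mathbf{A})<1$, all continuous encodings, and all readout functions $h$ that are either a real polynomial in the elements of $\sigma(\mathbf{x}^R_k)$ or a real polynomial in the elements of $\langle\mathbf{x}^R_k\rangle$. The subfamilies use $h$ polynomial in the elements of $\sigma(\mathbf{x}^R_k)$, $\alpha=0$,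 and encode the input into one parameter as $f(\mathbf{v}^\top\mathbf{s}_k)$, where $\mathbf{v}\in\mathbb{R}^n$ and the continuous function $f:\mathbb{R}\to\mathbb{R}$ are arbitrary and may vary with the instance: - $\mathcal{Q}_{\text{thermal}}$ (thermal states): $n_{th}=f(\mathbf{v}^\top\mathbf{s}_k)$ with $f\ge0$, and $r=0$; - $\mathcal{Q}_{\text{squeezed}}$ (squeezed vacuum, input in squeezing strength): $r=f(\mathbf{v}^\top\mathbf{s}_k)$, $n_{th}=0$, $\varphi$ constant; - $\mathcal{Q}_{\text{phase}}$ (squeezed vacuum, input in phase of squeezing): $\varphi=f(\mathbf{v}^\top\mathbf{s}_k)$, $n_{th}=0$, $r>0$ constant. *)

(* Defs.v *)
From HB Require Import structures.
From mathcomp Require Import all_boot all_order all_algebra.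
From mathcomp Require Import complex.
From mathcomp Require Import all_classical all_reals all_analysis.
From mathcomp Require mpoly.

Set Implicit Arguments.
Unset Strict Implicit.
Unset Printing Implicit Defensive.

Import Order.TTheory GRing.Theory Num.Theory.
Import numFieldNormedType.Exports.

Local Open Scope classical_set_scope.
Local Open Scope ring_scope.

(* [mpoly] is not imported, its notations clash with those of analysis. *)
Notation mpolynomial R d := (mpoly.mpoly d R).

Section Inputs.
Variables (R : realType) (n : nat).

(* The norm of the library on matrices is the sup norm. *)
Definition euclidean_norm (v : 'cV[R]_n) : R :=
  Num.sqrt (\sum_(i < n) v i 0 ^+ 2).

(* A left-infinite sequence is indexed backwards in time: [s k] is the input
   at time [- k]. *)
Definition input_seq := nat -> 'cV[R]_n.

Definition bounded_inputs (M : R) : set input_seq :=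
  [set s | forall k, euclidean_norm (s k) <= M].

(* Only used for differences of elements of [bounded_inputs], where the set is
   bounded. *)
Definition weighted_norm (w : nat -> R) (s : input_seq) : R :=
  sup (range (fun k => w k * euclidean_norm (s k))).

(* [decreasing_seq] is strict; relaxing it to non-increasing yields the same
   notion of fading memory. *)
Definition null_sequence (w : nat -> R) : Prop :=
  [/\ forall k, 0 < w k <= 1, decreasing_seq w & w @ \oo --> (0 : R)].

Definition functional (M : R) := bounded_inputs M -> R.

Definition fading_memory (M : R) : set (functional M) :=
  [set F | exists2 w, null_sequence w &
     forall (s : bounded_inputs M) (e : R), 0 < e ->
     exists2 d : R, 0 < d & forall s' : bounded_inputs M,
       weighted_norm w (fun k => val s' k - val s k) < d ->
       `|F s' - F s| < e].

Definition poly_algebra (M : R) (Fam : set (functional M)) :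
    set (functional M) :=
  [set G | exists (k : nat) (Fs : 'I_k -> functional M)
             (p : mpolynomial R k),
     (forall i, Fam (Fs i)) /\
     forall s, G s = mpoly.meval (fun i => Fs i s) p].

End Inputs.

Section HarmonicNetwork.
Variable R : realType.

(* The number of oscillators is N = nres.+1; the last one, of index [ord_max],
   is the ancilla. *)
Record harmonic_network := HarmonicNetwork {
  nres : nat;
  nres_gt0 : (0 < nres)%N;
  frequency : 'I_nres.+1 -> R;
  frequency_gt0 : forall i, 0 < frequency i;
  coupling : 'M[R]_(nres.+1);
  coupling_sym : forall i j, coupling i j = coupling j i;
  coupling_ge0 : forall i j, 0 <= coupling i j;
  coupling_diag : forall i, coupling i i = 0
}.

Arguments frequency : clear implicits.

Definition laplacian (N : nat) (g : 'M[R]_N) : 'M[R]_N :=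
  \matrix_(i, j) (if i == j then \sum_k g i k else - g i j).

Definition potential (net : harmonic_network) : 'M[R]_((nres net).+1) :=
  diag_mx (\row_i frequency net i ^+ 2) + laplacian (coupling net).

(* In the ordering (q_1, p_1, ..., q_N, p_N), coordinate [i] (counted from 0)
   belongs to oscillator [i./2], and is a momentum iff [i] is odd. *)
Definition oscillator (m : nat) (i : 'I_(m.*2 + 2)) : 'I_m.+1 := inord i./2.

(* The matrix X such that the equations dq/dt = p, dp/dt = - K q read
   dx/dt = X x. *)
Definition hamilton_matrix (m : nat) (K : 'M[R]_m.+1) : 'M[R]_(m.*2 + 2) :=
  \matrix_(i, j)
    (if odd i then
       (if odd j then 0 else - K (oscillator i) (oscillator j))
     else ((odd j) && (oscillator i == oscillator j))%:R).

Definition linear_flow (N : nat) (X : 'M[R]_N) (S : R -> 'M[R]_N) : Prop :=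
  S 0 = 1%:M /\
  forall (t : R) i j, is_derive t (1 : R) (fun u => S u i j) ((X *m S t) i j).

(* The largest modulus of a complex eigenvalue. *)
Definition spectral_radius (N : nat) (A : 'M[R]_N) : R :=
  sup [set Normc.normc z | z in
    [set z : R[i] | eigenvalue (map_mx (real_complex R) A) z]].

End HarmonicNetwork.

Arguments frequency {R}.

Section Encoding.
Variables (R : realType) (n : nat).

Record encoding := Encoding {
  n_thermal : 'cV[R]_n -> R;
  squeezing : 'cV[R]_n -> R;
  squeezing_phase : 'cV[R]_n -> R;
  alpha_abs : 'cV[R]_n -> R;
  alpha_arg : 'cV[R]_n -> R;
  n_thermal_continuous : continuous n_thermal;
  squeezing_continuous : continuous squeezing;
  squeezing_phase_continuous : continuous squeezing_phase;
  alpha_abs_continuous : continuous alpha_abs;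
  alpha_arg_continuous : continuous alpha_arg;
  n_thermal_ge0 : forall u, 0 <= n_thermal u;
  alpha_abs_ge0 : forall u, 0 <= alpha_abs u
}.

Definition cosh (x : R) : R := (expR x + expR (- x)) / 2.
Definition sinh (x : R) : R := (expR x - expR (- x)) / 2.

Variables (Omega : R) (enc : encoding) (u : 'cV[R]_n).

Definition ancilla_cov : 'M[R]_2 :=
  let r2 := 2 * squeezing enc u in let phi := squeezing_phase enc u in
  (n_thermal enc u + 2^-1) *:
  \matrix_(i, j)
    (if i == 0 then
       if j == 0 then (cosh r2 + cos phi * sinh r2) * Omega^-1
       else sin phi * sinh r2
     else
       if j == 0 then sin phi * sinh r2
       else (cosh r2 - cos phi * sinh r2) * Omega).

Definition ancilla_mean : 'cV[R]_2 :=
  let a := alpha_abs enc u in let theta := alpha_arg enc u in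
  \col_i (if i == 0 then a * cos theta * Num.sqrt (2 * Omega^-1)
          else a * sin theta * Num.sqrt (2 * Omega)).

End Encoding.

Section Reservoir.
Variables (R : realType) (n : nat) (dt : R).

(* [d] is the dimension 2(N-1) of the reservoir phase space. *)
Inductive readout (d : nat) :=
| CovReadout of mpolynomial R (d * d)
| MeanReadout of mpolynomial R d.

Definition eval_readout d (h : readout d) (mean : 'cV[R]_d) (cov : 'M[R]_d) :=
  match h with
  | CovReadout p => mpoly.meval (fun i => mxvec cov 0 i) p
  | MeanReadout p => mpoly.meval (fun i => mean i 0) p
  end.

Record reservoir := Reservoir {
  net : harmonic_network R;
  flow : R -> 'M[R]_((nres net).*2 + 2);
  flowP : linear_flow (hamilton_matrix (potential net)) flow;
  spectral_radius_lt1 : spectral_radius (ulsubmx (flow dt)) < 1;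
  enc : encoding R n;
  readout_of : readout (nres net).*2
}.

Variable sys : reservoir.

Definition blockA : 'M[R]_((nres (net sys)).*2) := ulsubmx (flow sys dt).
Definition blockB : 'M[R]_((nres (net sys)).*2, 2) := ursubmx (flow sys dt).
Definition ancilla_frequency : R := frequency (net sys) ord_max.

(* The moments at time 0 of the reservoir driven by the whole past [s], as the
   sums of the series obtained by iterating
     <x_k> = A <x_{k-1}> + B <x^A_k>,
     sigma(x_k) = A sigma(x_{k-1}) A^T + B sigma(x^A_k) B^T. *)
Definition reservoir_mean (s : input_seq R n) : 'cV[R]_((nres (net sys)).*2) :=
  limn (series (fun j => blockA ^+ j *m blockB
    *m ancilla_mean ancilla_frequency (enc sys) (s j))).

Definition reservoir_cov (s : input_seq R n) : 'M[R]_((nres (net sys)).*2) :=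
  limn (series (fun j => blockA ^+ j *m blockB
    *m ancilla_cov ancilla_frequency (enc sys) (s j)
    *m blockB^T *m blockA^T ^+ j)).

Definition output (s : input_seq R n) : R :=
  eval_readout (readout_of sys) (reservoir_mean s) (reservoir_cov s).

Definition cov_readout : Prop := exists p, readout_of sys = CovReadout p.

Definition zero_displacement : Prop := forall u, alpha_abs (enc sys) u = 0.

Definition linear_encoding (par : 'cV[R]_n -> R) (f : R -> R) : Prop :=
  exists v : 'cV[R]_n, forall u, par u = f ((v^T *m u) 0 0).

Definition thermal : Prop :=
  exists f : R -> R,
    [/\ continuous f, forall x, 0 <= f x,
        linear_encoding (n_thermal (enc sys)) f &
        forall u, squeezing (enc sys) u = 0].

Definition squeezed : Prop :=
  exists f : R -> R,
    [/\ continuous f, linear_encoding (squeezing (enc sys)) f,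
        forall u, n_thermal (enc sys) u = 0 &
        exists phi : R, forall u, squeezing_phase (enc sys) u = phi].

Definition phase_squeezed : Prop :=
  exists f : R -> R,
    [/\ continuous f, linear_encoding (squeezing_phase (enc sys)) f,
        forall u, n_thermal (enc sys) u = 0 &
        exists2 r : R, 0 < r & forall u, squeezing (enc sys) u = r].

End Reservoir.

Section Families.
Variables (R : realType) (n : nat) (M dt : R).

Definition induced (P : reservoir n dt -> Prop) : set (functional n M) :=
  [set F | exists2 sys, P sys & forall s, F s = output sys (val s)].

Definition Q : set (functional n M) := induced (fun=> True).

Definition Q_thermal : set (functional n M) :=
  induced (fun sys => [/\ cov_readout sys, zero_displacement sys &
                          thermal sys]).

Definition Q_squeezed : set (functional n M) :=
  induced (fun sys => [/\ cov_readout sys, zero_displacement sys &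
                          squeezed sys]).

Definition Q_phase : set (functional n M) :=
  induced (fun sys => [/\ cov_readout sys, zero_displacement sys &
                          phase_squeezed sys]).

End Families.

Arguments bounded_inputs {R} n M.
Arguments Q {R} n M dt.
Arguments Q_thermal {R} n M dt.
Arguments Q_squeezed {R} n M dt.
Arguments Q_phase {R} n M dt.

(* Main.v *)
Require Import Defs.
From HB Require Import structures.
From mathcomp Require Import all_boot all_order all_algebra.
From mathcomp Require Import complex.
From mathcomp Require Import all_classical all_reals all_analysis.
From mathcomp Require Import ring lra zify.
From mathcomp Require mpoly.

(* Functionals with fading memory are the continuous functions on
   K_M for the topology of pointwise convergence, and K_M is compact in that
   topology, so universality follows from separation by the Stone-Weierstrass
   theorem.

   An output has fading memory because the powers of A decay geometrically: by
   the Cayley-Hamilton theorem they satisfy a linear recurrence whose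
   characteristic roots have modulus less than 1.

   Two oscillators suffice for separation.  Give them the normal frequencies
   pi / dt and 2 pi / dt with normal modes along (4, 3) and (3, -4): the
   half-turn of the first mode and the full turn of the second make
   A = - 7/25 and B = - 24/25 scalar, with K coming from positive frequencies
   and couplings.  The variance of the first position is then a constant
   multiple of the sum over j of q ^ j g (s_j) with q = (7/25) ^ 2 < 1/2, where
   each of the three encodings lets g be affine in a ramp with values in [0, 1];
   choosing the ramp to be 0 and 1 at the first pair of different inputs, this
   first difference exceeds all the later ones together. *)

Set Implicit Arguments.
Unset Strict Implicit.
Unset Printing Implicit Defensive.

Import Order.TTheory GRing.Theory Num.Def Num.Theory.
Import numFieldNormedType.Exports.
Local Open Scope classical_set_scope.
Local Open Scope ring_scope.

(** * The Stone-Weierstrass theorem *)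

Lemma continuous_const (X Y : topologicalType) (c : Y) :
  continuous (fun _ : X => c).
Proof. by move=> x; exact: cvg_cst. Qed.

Section RealContinuity.
Variables (R : realType) (X : topologicalType).
Implicit Types f g : X -> R.

Lemma continuous_add_fun f g : continuous f -> continuous g ->
  continuous (fun x => f x + g x).
Proof. by move=> fc gc x; exact: cvgD (fc x) (gc x). Qed.

Lemma continuous_sub_fun f g : continuous f -> continuous g ->
  continuous (fun x => f x - g x).
Proof. by move=> fc gc x; exact: cvgB (fc x) (gc x). Qed.

Lemma continuous_mul_fun f g : continuous f -> continuous g ->
  continuous (fun x => f x * g x).
Proof. by move=> fc gc x; exact: cvgM (fc x) (gc x). Qed.

Lemma continuous_comp_fun f (g : R -> R) : continuous f -> continuous g ->
  continuous (fun x => g (f x)).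
Proof. by move=> fc gc x; exact: (continuous_comp (fc x) (gc _)). Qed.

End RealContinuity.

(** Compactness as an induction principle, standing in for finite subcovers. The complements of the
    sets satisfying P form a filter; if P failed on the whole space this filter would be proper, and
    at a cluster point the local hypothesis would contradict clustering. *)
Lemma compact_ind (X : topologicalType) (P : set X -> Prop) :
  compact [set: X] -> P set0 ->
  (forall A B, P A -> P B -> P (A `|` B)) ->
  (forall A B, A `<=` B -> P B -> P A) ->
  (forall x : X, exists2 U, nbhs x U & P U) -> P setT.
Proof.
move=> cX P0 PU PS Px; apply: contrapT => nPT.
pose F : set_system X := [set A | P (~` A)].
have FF : ProperFilter F.
  apply: Build_ProperFilter_ex.
    move=> B FB; apply/set0P/eqP => B0; apply: nPT.
    by move: FB; rewrite /F /= B0 setC0.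
  split; first by rewrite /F /= setCT.
    by move=> A B FA FB; rewrite /F /= setCI; exact: PU.
  by move=> A B AB; apply: PS; exact: subsetC.
have [|x [_ clx]] := cX F FF; first by rewrite /F /= setCT.
have [U Ux PUx] := Px x.
have [||y [/= nUy Uy]] := clx (~` U) U => //.
by rewrite /F /= setCK.
Qed.

Section StoneWeierstrass.
Variables (R : realType) (X : topologicalType).
Implicit Types (f g h : X -> R) (A : set (X -> R)).

Lemma compact_continuous_bounded f : compact [set: X] -> continuous f ->
  exists2 c, 0 < c & forall x, `|f x| <= c.
Proof.
move=> cX fc; pose P (B : set X) := exists2 c, 0 < c & forall x, B x -> `|f x| <= c.
suff [c c0 H] : P setT by exists c => // x; exact: H.
apply: (@compact_ind X P) => //.
- by exists 1.
- move=> A B [c c0 Ac] [d d0 Bd]; exists (c + d); first exact: addr_gt0.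
  move=> x [/Ac|/Bd] H; apply: le_trans H _; lra.
- by move=> A B AB [c c0 Bc]; exists c => // x /AB /Bc.
- move=> x; exists [set y | `|f x - f y| < 1].
    by have /cvgr_dist_lt := fc x; apply.
  exists (`|f x| + 1) => [|y /= H]; first by have := normr_ge0 (f x); lra.
  rewrite -[f y](subKr (f x)) (le_trans (ler_normB _ _))//; lra.
Qed.

(* The classical Newton-type iteration for |t| = sqrt (t ^ 2). *)
Fixpoint abs_poly (k : nat) (t : R) : R :=
  if k is k'.+1 then
    let p := abs_poly k' t in p + (t * t - p * p) / 2
  else 0.

(** The error d is multiplied at each step by 1 - |t| + d / 2, which is at most 1 - d / 2 since d <=
    |t|; this is why the bound by |t| is carried through the induction. *)
Lemma abs_polyP k (t : R) : `|t| <= 1 ->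
  0 <= `|t| - abs_poly k t <= Num.min `|t| (2 / k.+2%:R).
Proof.
move=> t1; have t0 := normr_ge0 t; elim: k => [|k IH] /=.
  by rewrite subr0 t0 /= le_min lexx /= divff ?t1 ?pnatr_eq0.
set p := abs_poly k t in IH *; set d := `|t| - p in IH *.
move: IH; rewrite le_min => /and3P[d0 dt dk].
have -> : `|t| - (p + (t * t - p * p) / 2) = d * (1 - `|t| + d / 2).
  have -> : t * t = `|t| * `|t| by rewrite -normrM ger0_norm // -expr2 sqr_ge0.
  by rewrite /d; field.
rewrite mulr_ge0 //=; last by lra.
rewrite le_min; apply/andP; split.
  apply: le_trans (_ : d <= _) => //; apply: ler_piMr => //; lra.
apply: (@le_trans _ _ (d * (1 - d / 2))); first by apply: ler_wpM2l => //; lra.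
have k0 : (0 : R) <= k%:R by rewrite ler0n.
have Hk : k.+2%:R = k%:R + 2 :> R by rewrite -natrD addn2.
have Hk3 : k.+3%:R = k%:R + 3 :> R by rewrite -natrD addn3.
rewrite Hk3; rewrite Hk in dk.
set n : R := k%:R in k0 dk *.
set q := 2 / (n + 2) in dk.
have q1 : q <= 1 by rewrite ler_pdivrMr ?mul1r; lra.
(* The map x (1 - x / 2) is increasing on [0, 1], so d may be replaced by its bound q. What remains
   is (n + 1) (n + 3) <= (n + 2) ^ 2. *)
apply: (@le_trans _ _ (q * (1 - q / 2))).
  rewrite -subr_ge0.
  have -> : q * (1 - q / 2) - d * (1 - d / 2) = (q - d) * (1 - (q + d) / 2) by field.
  by apply: mulr_ge0; lra.
have -> : q * (1 - q / 2) = 2 * (n + 1) / ((n + 2) * (n + 2)).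
  by rewrite /q; field; lra.
rewrite ler_pdivrMr; last by nra.
rewrite mulrAC ler_pdivlMr; [nra|lra].
Qed.

Record subalgebra A : Prop := Subalgebra {
  subalgebra_cst : forall c, A (fun=> c);
  subalgebraD : forall f g, A f -> A g -> A (fun x => f x + g x);
  subalgebraM : forall f g, A f -> A g -> A (fun x => f x * g x) }.

Definition uniform_closure A : set (X -> R) :=
  [set f | forall e, 0 < e -> exists2 g, A g & forall x, `|f x - g x| < e].

Section Closure.
Variable A : set (X -> R).
Hypotheses (cX : compact [set: X]) (algA : subalgebra A)
  (contA : forall f, A f -> continuous f).

(** Continuity is kept next to membership in the closure because the second compactness argument of
    [stone_weierstrass] takes neighbourhoods defined by elements of the closure. *)
Let cl f := continuous f /\ uniform_closure A f.

Lemma sub_uniform_closure f : A f -> cl f.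
Proof.
move=> Af; split; first exact: contA.
by move=> e e0; exists f => // x; rewrite subrr normr0.
Qed.

(** Dividing an approximant g by a bound c of |g| brings its values into [-1, 1], where [abs_poly]
    approximates the absolute value without leaving A. The error c * 2 / (k + 2) is made smaller
    than e / 2. *)
Lemma uniform_closure_norm f : cl f -> cl (fun x => `|f x|).
Proof.
move=> [fc clf]; split=> [x|e e0].
  by apply: (@continuous_comp _ _ _ f Num.norm); [exact: fc|exact: norm_continuous].
have [g Ag fg] := clf (e / 2) ltac:(by rewrite divr_gt0).
have [c c0 gc] := compact_continuous_bounded cX (contA Ag).
have [k] : exists k : nat, 2 / k.+2%:R < e / 2 / c.
  exists (Num.truncn (2 / (e / 2 / c))).
  have ec : 0 < e / 2 / c by rewrite !divr_gt0.
  rewrite ltr_pdivrMr ?ltr0n // mulrC -ltr_pdivrMr //.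
  apply: lt_trans (truncnS_gt _) _; by rewrite ltr_nat.
move=> Hk; exists (fun x => c * abs_poly k (c^-1 * g x)).
  apply: (subalgebraM algA (subalgebra_cst algA c)).
  have Acg := subalgebraM algA (subalgebra_cst algA c^-1) Ag.
  elim: k {Hk} => [|k IH]; first exact: subalgebra_cst.
  apply: (subalgebraD algA IH).
  apply: (subalgebraM algA _ (subalgebra_cst algA _)).
  apply: (subalgebraD algA); first exact: (subalgebraM algA).
  have -> : (fun x => - (abs_poly k (c^-1 * g x) * abs_poly k (c^-1 * g x))) =
     (fun x => (-1) * (abs_poly k (c^-1 * g x) * abs_poly k (c^-1 * g x))).
    by apply/funext => x; rewrite mulN1r.
  by apply: (subalgebraM algA (subalgebra_cst algA _)); exact: (subalgebraM algA).
move=> x; have fgx := fg x; set t := c^-1 * g x.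
have t1 : `|t| <= 1.
  by rewrite /t normrM gtr0_norm ?invr_gt0 // mulrC ler_pdivrMr // mul1r.
have /andP[H1] := abs_polyP k t1; rewrite le_min => /andP[_ H2].
have gE : `|g x| = c * `|t|.
  by rewrite /t normrM [`|c^-1|]gtr0_norm ?invr_gt0 // mulrA divff ?mul1r ?gt_eqF.
have -> : `|f x| - c * abs_poly k t = (`|f x| - `|g x|) + c * (`|t| - abs_poly k t).
  by rewrite gE; ring.
rewrite (le_lt_trans (ler_normD _ _)) //.
rewrite [e]splitr; apply: ltrD.
  by rewrite (le_lt_trans (ler_dist_dist _ _)).
rewrite normrM (gtr0_norm c0) ger0_norm // mulrC -ltr_pdivlMr //.
exact: le_lt_trans H2 Hk.
Qed.

Lemma uniform_closureD f g : cl f -> cl g -> cl (fun x => f x + g x).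
Proof.
move=> [fc clf] [gc clg]; split=> [x|e e0]; first exact: cvgD (fc x) (gc x).
have [f' Af ff'] := clf (e / 2) ltac:(by rewrite divr_gt0).
have [g' Ag gg'] := clg (e / 2) ltac:(by rewrite divr_gt0).
exists (fun x => f' x + g' x); first exact: (subalgebraD algA).
move=> x; rewrite opprD addrACA (le_lt_trans (ler_normD _ _)) // [e]splitr.
exact: ltrD.
Qed.

Lemma uniform_closureZ c f : cl f -> cl (fun x => c * f x).
Proof.
move=> [fc clf]; split=> [x|e e0]; first exact: cvgMr (fc x).
have c1 : 0 < `|c| + 1 by have := normr_ge0 c; lra.
have [f' Af ff'] := clf (e / (`|c| + 1)) ltac:(by rewrite divr_gt0).
exists (fun x => c * f' x); first exact: (subalgebraM algA (subalgebra_cst algA c)).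
move=> x; rewrite -mulrBr normrM.
apply: (@le_lt_trans _ _ ((`|c| + 1) * `|f x - f' x|)).
  by apply: ler_wpM2r => //; lra.
by rewrite mulrC -ltr_pdivlMr.
Qed.

Lemma uniform_closure_max f g : cl f -> cl g -> cl (fun x => Num.max (f x) (g x)).
Proof.
move=> clf clg.
have -> : (fun x => Num.max (f x) (g x)) =
    (fun x => 2^-1 * ((f x + g x) + `|f x + (-1) * g x|)).
  by apply/funext => x; rewrite maxr_absE mulN1r mulrC.
apply: uniform_closureZ; apply: uniform_closureD; first exact: uniform_closureD.
by apply: uniform_closure_norm; apply: uniform_closureD => //; exact: uniform_closureZ.
Qed.

Lemma uniform_closure_min f g : cl f -> cl g -> cl (fun x => Num.min (f x) (g x)).
Proof.
move=> clf clg.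
have -> : (fun x => Num.min (f x) (g x)) =
    (fun x => (-1) * Num.max ((-1) * f x) ((-1) * g x)).
  by apply/funext => x; rewrite !mulN1r oppr_max !opprK.
by apply: uniform_closureZ; apply: uniform_closure_max; exact: uniform_closureZ.
Qed.

Hypothesis sepA : forall x y, x <> y -> exists2 f, A f & f x <> f y.

Lemma subalgebra_interpolation f x y :
  exists h, [/\ A h, h x = f x & h y = f y].
Proof.
have [<-|xy] := pselect (x = y).
  by exists (fun=> f x); split=> //; exact: subalgebra_cst.
have [g Ag /eqP gxy] := sepA xy.
exists (fun z => f x + (f y - f x) / (g y - g x) * (g z + - g x)); split.
- apply: (subalgebraD algA (subalgebra_cst algA _)).
  apply: (subalgebraM algA (subalgebra_cst algA _)).
  exact: (subalgebraD algA Ag (subalgebra_cst algA _)).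
- by rewrite subrr mulr0 addr0.
- have gyx : g y - g x != 0 by rewrite subr_eq0 eq_sym.
  by rewrite divfK // addrC subrK.
Qed.

(** Two rounds of compactness. For fixed x, maxima of interpolants through x and y, over finitely
    many y, lie above f - e everywhere and still agree with f at x. Minima of these, over finitely
    many x, also lie below f + e. *)
Theorem stone_weierstrass f : continuous f -> uniform_closure A f.
Proof.
move=> fc.
have below e x : 0 < e ->
    exists g, [/\ cl g, g x = f x & forall z, f z - e < g z].
  move=> e0.
  pose P (B : set X) := exists g,
    [/\ cl g, g x = f x & forall z, B z -> f z - e < g z].
  suff [g [clg gx H]] : P setT by exists g; split=> // z; exact: H.
  apply: (@compact_ind X P) => //.
  - exists (fun=> f x); split=> //.
    exact: sub_uniform_closure (subalgebra_cst algA _).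
  - move=> B C [g [clg gx gB]] [h [clh hx hC]].
    exists (fun z => Num.max (g z) (h z)); split; first exact: uniform_closure_max.
      by rewrite gx hx maxxx.
    by move=> z [/gB|/hC] H; rewrite lt_max H ?orbT.
  - by move=> B C BC [g [clg gx gC]]; exists g; split=> // z /BC /gC.
  - move=> y; have [h [Ah hx hy]] := subalgebra_interpolation f x y.
    exists [set z | f z - e < h z].
      have /cvgr_gt := continuous_sub_fun (contA Ah) fc (x := y).
      rewrite hy subrr => /(_ (- e)); rewrite oppr_lt0 => /(_ e0).
      by apply: filterS => z; rewrite /mkset; lra.
    by exists h; split=> //; exact: sub_uniform_closure.
move=> e e0.
pose P (B : set X) := exists g, [/\ cl g,
  forall z, f z - e / 2 < g z & forall z, B z -> g z < f z + e / 2].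
suff [g [[_ clg] gl gu]] : P setT.
  have [h Ah gh] := clg (e / 2) ltac:(by rewrite divr_gt0).
  exists h => // x; rewrite -(subrKA (g x)) (le_lt_trans (ler_normD _ _)) // [e]splitr.
  by apply: ltrD => //; have := gl x; have := gu x I; rewrite ltr_norml; lra.
apply: (@compact_ind X P) => //.
(* Over the empty set the upper bound is void, but the lower bound must hold everywhere: a constant
   bounding |f| does it. *)
- have [c c0 Hc] := compact_continuous_bounded cX fc.
  exists (fun=> c); split=> // [|z]; first exact: sub_uniform_closure (subalgebra_cst algA _).
  by have := Hc z; have := ler_norm (f z); lra.
- move=> B C [g [clg gl gB]] [h [clh hl hC]].
  exists (fun z => Num.min (g z) (h z)); split; first exact: uniform_closure_min.
    by move=> z; rewrite lt_min gl hl.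
  by move=> z [/gB|/hC] H; rewrite gt_min H ?orbT.
- by move=> B C BC [g [clg gl gC]]; exists g; split=> // z /BC /gC.
- move=> x; have [|g [clg gx gl]] := below (e / 2) x; first by rewrite divr_gt0.
  exists [set z | g z < f z + e / 2].
    have /cvgr_lt := continuous_sub_fun clg.1 fc (x := x).
    rewrite gx subrr => /(_ (e / 2)); rewrite divr_gt0 // => /(_ isT).
    by apply: filterS => z; rewrite /mkset; lra.
  by exists g; split.
Qed.

End Closure.
End StoneWeierstrass.

(** * Geometric decay of matrix powers *)

Section MatrixNorm.
Variable R : realType.

Lemma ler_mx_norm_entry m n (A : 'M[R]_(m, n)) i j : `|A i j| <= `|A|.
Proof.
rewrite [leRHS]/normr /= mx_normrE.
by apply: (le_bigmax _ (fun ij => `|A ij.1 ij.2|) (i, j)).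
Qed.

Lemma mx_norm_ler m n (A : 'M[R]_(m, n)) c :
  0 <= c -> (forall i j, `|A i j| <= c) -> `|A| <= c.
Proof.
move=> c0 Ac; rewrite [leLHS]/normr /= mx_normrE.
by apply/bigmax_leP; split=> // ij _; exact: Ac.
Qed.

Lemma mx_norm_mulmx m n p (A : 'M[R]_(m, n)) (B : 'M[R]_(n, p)) :
  `|A *m B| <= n%:R * (`|A| * `|B|).
Proof.
apply: mx_norm_ler => [|i j]; first by rewrite !mulr_ge0.
rewrite mxE (le_trans (ler_norm_sum _ _ _)) //.
rewrite -[n in n%:R]card_ord mulr_natl -sumr_const ler_sum // => k _.
by rewrite normrM ler_pM // ler_mx_norm_entry.
Qed.

Lemma mx_norm_mulmx_le m n p (A : 'M[R]_(m, n)) (B : 'M[R]_(n, p)) a b :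
  `|A| <= a -> `|B| <= b -> `|A *m B| <= n%:R * (a * b).
Proof.
move=> Aa Bb; apply: le_trans (mx_norm_mulmx _ _) _.
by apply: ler_wpM2l => //; exact: ler_pM.
Qed.

Lemma mx_norm_trmx m n (A : 'M[R]_(m, n)) : `|A^T| = `|A|.
Proof.
apply/eqP; rewrite eq_le; apply/andP; split; apply: mx_norm_ler => // i j.
  by rewrite mxE ler_mx_norm_entry.
by have := ler_mx_norm_entry A^T j i; rewrite mxE.
Qed.

End MatrixNorm.

(** * Decay of powers from the spectral radius *)

Section GeometricDecay.
Variable R : realType.

Definition geometric_decay (u : nat -> R) :=
  exists c q, [/\ 0 <= c, 0 <= q < 1 & forall j, u j <= c * q ^+ j].

Lemma geometric_decay_le u v :
  (forall j, u j <= v j) -> geometric_decay v -> geometric_decay u.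
Proof.
by move=> uv [c [q [c0 q01 H]]]; exists c, q; split=> // j; apply: le_trans (H j).
Qed.

Lemma geometric_decay_recurrence (a : R) u v : 0 <= a < 1 ->
  (forall j, u j.+1 <= a * u j + v j) -> geometric_decay v ->
  geometric_decay u.
Proof.
move=> /andP[a0 a1] uv [c [q [c0 /andP[q0 q1] vcq]]].
(* The rate p is at least q and strictly above a, even when q <= a. So c / (p - a) is meaningful,
   and the constant d satisfies a d + c <= d p, which closes the induction. *)
pose p := Num.max q ((1 + a) / 2).
have qp : q <= p by rewrite le_max lexx.
have ap : a < p by rewrite lt_max; apply/orP; right; lra.
have p1 : p < 1 by rewrite gt_max q1 /=; lra.
have p0 : 0 <= p by exact: le_trans qp.
pose d := Num.max `|u 0%N| (c / (p - a)).
have d0 : 0 <= d by rewrite le_max normr_ge0.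
have cd : a * d + c <= d * p.
  have : c / (p - a) <= d by rewrite le_max lexx orbT.
  rewrite ler_pdivrMr; [lra|by rewrite subr_gt0].
exists d, p; split=> //; first by rewrite p0.
elim=> [|j IH]; first by rewrite mulr1 le_max ler_norm.
rewrite (le_trans (uv j)) //.
apply: (@le_trans _ _ (a * (d * p ^+ j) + c * p ^+ j)).
  apply: lerD; first exact: ler_wpM2l.
  by apply: le_trans (vcq j) _; apply: ler_wpM2l => //; exact: lerXn2r.
rewrite exprS (_ : _ + _ = (a * d + c) * p ^+ j); last by ring.
by rewrite mulrA ler_wpM2r // exprn_ge0.
Qed.

(** A real-valued norm for complex matrices that is a plain sum over entries, so that the recurrence
    with factor |z| can be checked entry by entry. *)
Let mx_sum_norm m n (A : 'M[R[i]]_(m, n)) := \sum_i \sum_j Normc.normc (A i j).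

Lemma normc_real_complex (x : R) : Normc.normc (real_complex R x) = `|x|.
Proof. by rewrite /Normc.normc /= expr0n addr0 sqrtr_sqr. Qed.

Lemma normc_ge0 (z : R[i]) : 0 <= Normc.normc z.
Proof. by case: z => x y; exact: sqrtr_ge0. Qed.

(* Peels the factors of the polynomial off one at a time, each one being a
   first-order recurrence for the powers of the matrix. *)
Lemma mx_powers_decay_factors m (A : 'M[R[i]]_m.+1) (s : seq R[i]) :
  (forall z, z \in s -> Normc.normc z < 1) ->
  geometric_decay (fun j => mx_sum_norm
    (A ^+ j *m horner_mx A (\prod_(z <- s) ('X - z%:P)))) ->
  geometric_decay (fun j => mx_sum_norm (A ^+ j)).
Proof.
elim: s => [_|z s IH s1].
  by rewrite big_nil rmorph1; under eq_fun do rewrite mulmx1.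
move=> H; apply: IH => [y ys|]; first by rewrite s1 // inE ys orbT.
move: H; apply: (@geometric_decay_recurrence (Normc.normc z)).
  by rewrite normc_ge0 s1 // mem_head.
move=> j; rewrite big_cons rmorphM rmorphB /= horner_mx_X horner_mx_C.
set P := horner_mx A _.
have -> : A ^+ j.+1 *m P = z *: (A ^+ j *m P) + A ^+ j *m ((A - z%:M) * P).
  rewrite mulrBl mulmxBr -!mulmxE mul_scalar_mx -scalemxAr.
  by rewrite exprSr -!mulmxE -!mulmxA addrCA subrr addr0.
rewrite /mx_sum_norm mulr_sumr -big_split /= ler_sum // => i _.
rewrite mulr_sumr -big_split /= ler_sum // => k _.
by rewrite !mxE (le_trans (@le_normcD _ _ _)) // Normc.normcM.
Qed.

Lemma char_poly_roots (m : nat) (A : 'M[R[i]]_m) :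
  exists2 s, char_poly A = \prod_(z <- s) ('X - z%:P) &
    forall z, eigenvalue A z = (z \in s).
Proof.
have [s] := closed_field_poly_normal (char_poly A).
rewrite (monicP (char_poly_monic A)) scale1r => sE; exists s => // z.
by rewrite eigenvalue_root_char sE root_prod_XsubC.
Qed.

Lemma eigenvalue_le_spectral_radius m (A : 'M[R]_m) z :
  eigenvalue (map_mx (real_complex R) A) z ->
  Normc.normc z <= spectral_radius A.
Proof.
move=> Az; apply: ub_le_sup; last by exists z.
have [s _ sE] := char_poly_roots (map_mx (real_complex R) A).
(* A supremum bounds its set only if the set is bounded: the eigenvalues are among the finitely many
   roots in s, and each modulus is at most the sum of all. *)
exists (\sum_(y <- s) Normc.normc y) => _ [y + <-].
rewrite /mkset sE => ys; rewrite (big_rem y) //= lerDl sumr_ge0 // => x _.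
exact: normc_ge0.
Qed.

Lemma spectral_radius_decay m (A : 'M[R]_m) : spectral_radius A < 1 ->
  geometric_decay (fun j => `|A ^+ j|).
Proof.
case: m A => [|m] A A1.
  exists 0, 0; split=> // [|j]; first by rewrite lexx ltr01.
  by rewrite mul0r [_ ^+ _]flatmx0 normr0.
pose B := map_mx (real_complex R) A.
have [s sE BE] := char_poly_roots B.
have : geometric_decay (fun j => mx_sum_norm (B ^+ j)).
  (* With all the factors present the product is the characteristic polynomial, so the sequence is
     zero by Cayley-Hamilton and the peeling can start. *)
  apply: (@mx_powers_decay_factors _ _ s) => [z|].
    by rewrite -BE => /eigenvalue_le_spectral_radius /le_lt_trans; apply.
  exists 0, 0; split=> // [|j]; first by rewrite lexx ltr01.
  rewrite mul0r -sE Cayley_Hamilton mulmx0 /mx_sum_norm.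
  rewrite big1 // => i _; rewrite big1 // => k _; rewrite mxE.
  exact: Normc.normc0.
apply: geometric_decay_le => j; apply: mx_norm_ler => [|i k].
  by apply: sumr_ge0 => ? _; apply: sumr_ge0 => ? _; exact: normc_ge0.
rewrite /mx_sum_norm (bigD1 i) //= (bigD1 k) //=.
have -> : Normc.normc ((B ^+ j) i k) = `|(A ^+ j) i k|.
  by rewrite /B -rmorphXn mxE normc_real_complex.
rewrite -addrA lerDl addr_ge0 //.
  by apply: sumr_ge0 => ? _; exact: normc_ge0.
by apply: sumr_ge0 => ? _; apply: sumr_ge0 => ? _; exact: normc_ge0.
Qed.

End GeometricDecay.

(** * The compact space of inputs *)

Section BigLimits.
Context {R : realType} {T I : Type} {F : set_system T} {FF : Filter F}.
Variables (r : seq I) (f : I -> T -> R) (a : I -> R).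
Hypothesis fa : forall i, f i @ F --> a i.

Lemma cvg_sumr : \sum_(i <- r) f i x @[x --> F] --> \sum_(i <- r) a i.
Proof. by apply: cvg_big => //; exact: add_continuous. Qed.

Lemma cvg_prodr : \prod_(i <- r) f i x @[x --> F] --> \prod_(i <- r) a i.
Proof. by apply: cvg_big => //; exact: mul_continuous. Qed.

End BigLimits.

Lemma cvg_initial (S : choiceType) (T : topologicalType) (w : S -> T)
    (F : set_system S) (s : S) :
  Filter F -> w @ F --> w s -> F --> (s : initial_topology w).
Proof.
move=> FF cF U [? /= [[W oW <-]] /= Wws WU].
by apply: filterS WU _; apply: cF; exact: open_nbhs_nbhs.
Qed.

Lemma cvg_prod_topology (I : Type) (T : I -> topologicalType)
    (F : set_system (prod_topology T)) (f : prod_topology T) :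
  Filter F -> (forall i, (fun g : prod_topology T => g i) @ F --> f i) -> F --> f.
Proof. by move=> FF H; apply/cvg_sup => i; exact: cvg_initial. Qed.

(** A filter on the subtype is pushed forward to T; its cluster point lies in A, hence lifts to the
    subtype. *)
Lemma set_type_compact (T : topologicalType) (A : set T) :
  compact A -> compact [set: A].
Proof.
move=> cA F FF _.
have FA : F (set_val @^-1` A).
  by apply: filterE => x; rewrite set_valE; exact: set_valP.
have [x [Ax clx]] := cA (set_val @ F) (fmap_proper_filter _ FF) FA.
exists (exist _ x (mem_set Ax)); split=> // U V FU [? /= [[W oW <-]] /=].
rewrite set_valE /= => Wx WV.
have FU' : F (set_val @^-1` ((val : A -> T) @` U)).
  by apply: filterS FU => y Uy; rewrite set_valE; exists y.
have [_ [[y Uy <-] Wy]] := clx _ W FU' (open_nbhs_nbhs (conj oW Wx)).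
by exists y; split=> //; exact: WV.
Qed.

Lemma cvg_mx {R : realType} {T : Type} {F : set_system T} {FF : Filter F} m n
    (f : T -> 'M[R]_(m, n)) (L : 'M[R]_(m, n)) :
  (forall i j, f x i j @[x --> F] --> L i j) -> f @ F --> L.
Proof.
move=> fL U [P PL PU]; apply: (@filterS _ F _ [set x | forall i j, P i j (f x i j)]).
  by move=> x Px; apply: PU.
apply: filter_forall => i; apply: filter_forall => j.
exact: fL (PL i j).
Qed.

Lemma continuous_distP {R : realType} (X : topologicalType)
    (V : normedModType R) (f : X -> V) :
  continuous f <->
  forall x e, 0 < e -> \forall y \near x, `|f x - f y| < e.
Proof.
split=> [fc x|H x]; first by have /cvgrPdist_lt := fc x.
by apply/cvgrPdist_lt => e; exact: H.
Qed.

Section EuclideanNorm.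
Variables (R : realType) (n : nat).
Implicit Types v : 'cV[R]_n.

Lemma mx_norm_le_euclidean v : `|v| <= euclidean_norm v.
Proof.
apply: mx_norm_ler => [|i j]; first exact: sqrtr_ge0.
rewrite ord1 -sqrtr_sqr ler_wsqrtr // (bigD1 i) //= lerDl.
by apply: sumr_ge0 => k _; exact: sqr_ge0.
Qed.

Lemma euclidean_le_mx_norm v : euclidean_norm v <= Num.sqrt n%:R * `|v|.
Proof.
rewrite -[`|v|]ger0_norm // -sqrtr_sqr -sqrtrM // ler_wsqrtr //.
rewrite -[n in n%:R]card_ord mulr_natl -sumr_const ler_sum // => k _.
by rewrite -real_normK ?num_real // lerXn2r ?nnegrE // ler_mx_norm_entry.
Qed.

Lemma euclidean_norm_continuous : continuous (@euclidean_norm R n).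
Proof.
move=> v; apply: continuous_comp; last exact: sqrt_continuous.
apply: (@cvg_sumr _ _ _ (nbhs v) _ _ (fun i (u : 'cV[R]_n) => u i 0 ^+ 2)
  (fun i => v i 0 ^+ 2)) => i.
apply: (@continuous_comp _ _ _ (fun u : 'cV[R]_n => u i 0) (fun x => x ^+ 2)).
  exact: coord_continuous.
exact: exprn_continuous.
Qed.

Lemma trmx_continuous m k : continuous (@trmx R m k).
Proof.
move=> A; apply: (@cvg_mx _ _ (nbhs A)) => i j; rewrite mxE.
under eq_fun do rewrite mxE.
exact: coord_continuous.
Qed.

Lemma euclidean_ball_compact (r : R) :
  compact [set v : 'cV[R]_n | euclidean_norm v <= r].
Proof.
(* [bounded_closed_compact] is about row vectors, so the ball is written as the image of a set of
   rows under transposition. *)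
have -> : [set v : 'cV[R]_n | euclidean_norm v <= r] =
    (fun u : 'rV[R]_n => u^T) @` [set u : 'rV[R]_n | euclidean_norm u^T <= r].
  apply/seteqP; split=> [v vr|_ [u ur <-] //].
  by exists v^T; rewrite /mkset trmxK.
apply: continuous_compact.
  exact/continuous_subspaceT/trmx_continuous.
apply: bounded_closed_compact.
  exists r; split; first exact: num_real.
  move=> c rc u /= ur; apply: le_trans (ltW rc); apply: le_trans ur.
  by rewrite -(mx_norm_trmx u) mx_norm_le_euclidean.
have -> : [set u : 'rV[R]_n | euclidean_norm u^T <= r] =
    (fun u : 'rV[R]_n => euclidean_norm u^T) @^-1` [set x | x <= r] by [].
apply: preimage_closed; last exact: closed_le.
move=> u _; apply: (@continuous_comp _ _ _ (@trmx R 1 n) (@euclidean_norm R n)).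
  exact: trmx_continuous.
exact: euclidean_norm_continuous.
Qed.

End EuclideanNorm.

(** * Fading memory as continuity for pointwise convergence *)

Section HistorySpace.
Variables (R : realType) (n : nat) (M : R).

(* Uniformly bounded inputs with the topology of pointwise convergence, which
   every null sequence metrizes. *)
Definition history_space : topologicalType :=
  set_type (bounded_inputs n M : set (prod_topology (fun=> 'cV[R]_n))).

Lemma history_space_compact : compact [set: history_space].
Proof.
apply: set_type_compact.
have : @compact (prod_topology (fun _ : nat => 'cV[R]_n))
    [set f | forall k, [set v : 'cV[R]_n | euclidean_norm v <= M] (f k)].
  apply: (@tychonoff nat (fun=> 'cV[R]_n)
    (fun=> [set v : 'cV[R]_n | euclidean_norm v <= M])).
  by move=> k; exact: euclidean_ball_compact.
by [].
Qed.

Lemma history_bounded (s : bounded_inputs n M) k :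
  euclidean_norm (val s k) <= M.
Proof. exact: (set_valP s). Qed.

Lemma history_coord_continuous k :
  continuous (fun s : history_space => val s k).
Proof.
rewrite -[X in continuous X](_ : (fun s : history_space => set_val s k) = _); last first.
  by rewrite set_valE.
move=> s; apply: (@continuous_comp history_space _ _ set_val
  (fun f : prod_topology (fun=> 'cV[R]_n) => f k)).
  exact: initial_continuous.
exact: proj_continuous.
Qed.

(** Bounds the distance of two inputs in K_M. The passage through the sup norm costs the factor sqrt
    n and spares the triangle inequality for [euclidean_norm]. *)
Let diam := Num.sqrt n%:R * (M + M).

Lemma history_dist_le (s s' : bounded_inputs n M) k :
  euclidean_norm (val s' k - val s k) <= diam.
Proof.
apply: le_trans (euclidean_le_mx_norm _) _; apply: ler_wpM2l.
  exact: sqrtr_ge0.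
apply: le_trans (ler_normB _ _) _; apply: lerD.
  exact: le_trans (mx_norm_le_euclidean _) (history_bounded s' k).
exact: le_trans (mx_norm_le_euclidean _) (history_bounded s k).
Qed.

Lemma diam_ge0 (s : bounded_inputs n M) : 0 <= diam.
Proof. exact: le_trans (sqrtr_ge0 _) (history_dist_le s s 0%N). Qed.

Lemma weighted_norm_ge w (s s' : bounded_inputs n M) k : null_sequence w ->
  w k * euclidean_norm (val s' k - val s k) <=
    weighted_norm w (fun j => val s' j - val s j).
Proof.
move=> [w01 _ _]; apply: ub_le_sup; last by exists k.
exists diam => _ [j _ <-]; have /andP[wj0 wj1] := w01 j.
rewrite -[diam]mul1r; apply: ler_pM => //; first exact: ltW.
  exact: sqrtr_ge0.
exact: history_dist_le.
Qed.

(** From some time m on the weights are so small that, K_M being bounded, every contribution stays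
    below d / 2; the finitely many earlier coordinates are controlled by a neighbourhood for
    pointwise convergence. *)
Lemma fading_memory_continuous (F : functional n M) :
  fading_memory F -> continuous (F : history_space -> R).
Proof.
move=> [w [w01 _ w0] Hw]; apply/continuous_distP => s e e0.
have [d d0 Hd] := Hw s e e0.
have d20 : 0 < d / 2 by rewrite divr_gt0.
have D0 := diam_ge0 s.
have [m _ Hm] : \forall k \near \oo, w k < d / 2 / (diam + 1).
  by apply: (cvgr_lt _ w0); rewrite divr_gt0 // ltr_wpDl.
have : nbhs s [set s' : bounded_inputs n M | forall k : 'I_m,
    euclidean_norm (val s' k - val s k) < d / 2].
  apply: (@filter_forall _ _ (fun (k : 'I_m) (s' : bounded_inputs n M) =>
    euclidean_norm (val s' k - val s k) < d / 2) _ (nbhs_filter s)) => k.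
  have /continuous_distP : continuous
      (fun s' : history_space => euclidean_norm (val s' k - val s k)).
    move=> s'; apply: (@continuous_comp history_space _ _
      (fun s' : history_space => val s' k - val s k)).
      apply: (@cvgB _ _ history_space (nbhs s') (nbhs_filter s')
        (fun s' : history_space => val s' k) (fun=> val s k)).
        exact: history_coord_continuous.
      exact: cvg_cst.
    exact: euclidean_norm_continuous.
  move=> /(_ s _ d20); apply: filterS => s'.
  rewrite subrr [euclidean_norm 0]/euclidean_norm big1 ?sqrtr0; last first.
    by move=> i _; rewrite mxE expr0n.
  by rewrite sub0r normrN ger0_norm ?sqrtr_ge0.
apply: filterS => s' Hs'; rewrite distrC; apply: Hd.
(* A supremum of terms below d / 2 is only known to be at most d / 2, hence the halving of d. *)
apply: (@le_lt_trans _ _ (d / 2)); last by lra.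
apply: ge_sup; first by exists (w 0%N * euclidean_norm (val s' 0%N - val s 0%N)), 0%N.
move=> _ [k _ <-]; have /andP[wk0 wk1] := w01 k.
have := sqrtr_ge0 (\sum_(i < n) (val s' k - val s k) i 0 ^+ 2).
rewrite -/(euclidean_norm _) => E0.
have [km|mk] := ltnP k m.
  rewrite -[d / 2]mul1r; apply: ler_pM => //; first exact: ltW.
  exact: ltW (Hs' (Ordinal km)).
have := Hm k mk; rewrite /mkset ltr_pdivlMr ?ltr_wpDl // => wk.
apply: le_trans (ltW wk); apply: ler_wpM2l; first exact: ltW.
by rewrite (le_trans (history_dist_le s s' k)) // lerDl.
Qed.

Lemma null_sequence_harmonic : null_sequence (fun k => k.+1%:R^-1 : R).
Proof.
split=> [k|i j|]; last exact: cvg_harmonic.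
  by rewrite invr_gt0 ltr0n /= invf_le1 ?ltr0n // ler1n.
by rewrite lef_pV2 ?posrE ?ltr0n // ler_nat ltnS.
Qed.

(** One weight serves for all functionals. The weighted balls around s generate a filter G that
    converges to s coordinate by coordinate, so every neighbourhood of s contains such a ball. *)
Lemma continuous_fading_memory (F : functional n M) :
  continuous (F : history_space -> R) -> fading_memory F.
Proof.
move=> Fc; set w := fun k : nat => k.+1%:R^-1 : R.
have nw : null_sequence w := null_sequence_harmonic.
exists w => // s e e0.
pose G : set_system history_space := filter_from [set d : R | 0 < d]
  (fun d => [set s' | weighted_norm w (fun k => val s' k - val s k) < d]).
have FG : Filter G.
  apply: filter_from_filter; first by exists 1 => /=.
  move=> c d c0 d0; exists (Num.min c d); first by rewrite /mkset lt_min c0.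
  by move=> s' /=; rewrite lt_min => /andP[].
have Gs : G --> (s : history_space).
  apply: (@cvg_initial history_space _ set_val G s FG).
  rewrite set_valE; apply: cvg_prod_topology => k; apply/cvgrPdist_lt => r r0.
  exists (w k * r); first by rewrite /= mulr_gt0 // invr_gt0 ltr0n.
  move=> s' /= /(le_lt_trans (weighted_norm_ge s s' k nw)).
  rewrite ltr_pM2l ?invr_gt0 ?ltr0n // => H.
  by rewrite distrC (le_lt_trans _ H) // mx_norm_le_euclidean.
have /continuous_distP /(_ s e e0) /Gs [d d0 H] := Fc.
by exists d => // s' /H /=; rewrite distrC.
Qed.

End HistorySpace.

(** * Fading memory of the outputs *)

(** Lets matrices be used as a [completeNormedModType], the setting of the series below. *)
HB.instance Definition _ (R : realType) m n := NormedModule.on 'M[R]_(m, n).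

Section GeometricSeries.
Variables (R : realType) (V : completeNormedModType R) (c q : R).
Hypothesis q01 : 0 <= q < 1.

Section Tail.
Variable u : nat -> V.
Hypothesis ucq : forall j, `|u j| <= c * q ^+ j.

Let q0 : 0 <= q. Proof. by case/andP: q01. Qed.
Let q1 : 0 < 1 - q. Proof. by rewrite subr_gt0; case/andP: q01. Qed.

Lemma geometric_bound_ge0 : 0 <= c.
Proof. by apply: le_trans (normr_ge0 _) _; have := ucq 0%N; rewrite mulr1; exact. Qed.

Lemma cvg_series_geometric : cvgn (series u).
Proof.
apply: normed_cvg; apply: (@series_le_cvg _ _ (geometric c q)) => //=.
- move=> j; rewrite mulr_ge0 ?exprn_ge0 //; exact: geometric_bound_ge0.
- by apply: is_cvg_geometric_series; rewrite ger0_norm // -subr_gt0.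
Qed.

Lemma series_geometric_tail N :
  `|limn (series u) - series u N| <= c * q ^+ N / (1 - q).
Proof.
have c0 := geometric_bound_ge0.
(* The exact value of the finite geometric sum is kept, factor 1 - q ^ k included, so that the
   induction on k closes with an equality. *)
have part k : `|series u (N + k)%N - series u N| <=
    c * q ^+ N / (1 - q) * (1 - q ^+ k).
  elim: k => [|k IH]; first by rewrite addn0 subrr normr0 expr0 subrr mulr0.
  rewrite addnS seriesSr addrAC (le_trans (ler_normD _ _)) //.
  apply: (le_trans (lerD IH (ucq _))); rewrite exprD exprS le_eqVlt.
  by apply/orP; left; apply/eqP; field; rewrite gt_eqF.
have cv : (fun m => `|series u m - series u N|) @ \oo -->
    `|limn (series u) - series u N|.
  by apply: cvg_norm; apply: cvgB; [exact: cvg_series_geometric|exact: cvg_cst].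
apply: (cvgr_to_le cv); exists N => // m /= Nm.
rewrite -(subnKC Nm) (le_trans (part _)) // ler_piMr //.
  by rewrite divr_ge0 ?mulr_ge0 ?exprn_ge0 // ltW.
by rewrite gerBl exprn_ge0.
Qed.

End Tail.

(** The bound is uniform in x, so one N makes the tails at all points smaller than e / 3; the
    partial sum up to N is continuous and contributes the last third. *)
Lemma series_geometric_continuous (X : topologicalType) (u : nat -> X -> V) :
  (forall j, continuous (u j)) -> (forall j x, `|u j x| <= c * q ^+ j) ->
  continuous (fun x => limn (series (fun j => u j x))).
Proof.
move=> uc ucq; apply/continuous_distP => x e e0.
have /andP[q0 q1] := q01.
have e3 : 0 < e / 3 by rewrite divr_gt0.
have [N _ HN] : \forall N \near \oo, c / (1 - q) * q ^+ N < e / 3.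
  have /cvgr_lt : geometric (c / (1 - q)) q @ \oo --> 0.
    by apply: cvg_geometric; rewrite ger0_norm.
  by apply.
have tail y : `|limn (series (fun j => u j y)) - series (fun j => u j y) N| < e / 3.
  apply: le_lt_trans (series_geometric_tail (ucq^~ y) N) _.
  by rewrite mulrAC; apply: HN => /=.
have : continuous (fun y => series (fun j => u j y) N).
  elim: N {HN tail} => [|N IH].
    under eq_fun do rewrite /series /= big_geq //.
    by move=> y; exact: cvg_cst.
  under eq_fun do rewrite seriesSr.
  by move=> y; exact: cvgD (IH y) (uc N y).
move=> /continuous_distP /(_ x _ e3); apply: filterS => y Hy.
have := tail x; have := tail y.
set a := limn _; set b := limn _; rewrite (distrC a) => yb xa.
set S := series _ N in Hy xa; set T := series _ N in Hy yb.
have := ler_distD S b a; have := ler_distD T S a.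
by move: Hy xa yb; lra.
Qed.

End GeometricSeries.

(** * Continuity of encodings, moments and outputs *)

Section MatrixContinuity.
Variable R : realType.

Lemma continuous_mx (X : topologicalType) m n (f : X -> 'M[R]_(m, n)) :
  (forall i j, continuous (fun x => f x i j)) -> continuous f.
Proof. by move=> fc x; apply: cvg_mx => i j; exact: fc. Qed.

Lemma continuous_coord (X : topologicalType) m n (f : X -> 'M[R]_(m, n)) i j :
  continuous f -> continuous (fun x => f x i j).
Proof.
move=> fc x; apply: (@continuous_comp _ _ _ f (fun A => A i j)); first exact: fc.
exact: coord_continuous.
Qed.

Lemma continuous_mulmx (X : topologicalType) m n p
    (f : X -> 'M[R]_(m, n)) (g : X -> 'M[R]_(n, p)) :
  continuous f -> continuous g -> continuous (fun x => f x *m g x).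
Proof.
move=> fc gc; apply: continuous_mx => i j.
under eq_fun do rewrite mxE.
move=> x.
apply: cvg_sumr => k.
by apply: cvgM; [exact: (continuous_coord fc)|exact: (continuous_coord gc)].
Qed.

Lemma continuous_meval (X : topologicalType) d (f : 'I_d -> X -> R)
    (p : mpolynomial R d) :
  (forall i, continuous (f i)) ->
  continuous (fun x => mpoly.meval (fun i => f i x) p).
Proof.
move=> fc; under eq_fun do rewrite mpoly.mevalE.
move=> x.
apply: cvg_sumr => m.
apply: cvgM; first exact: cvg_cst.
apply: cvg_prodr => i.
exact: (@cvg_comp _ _ _ (f i) (fun t => t ^+ mpoly.fun_of_multinom m i) _ _ _ (fc i x)
  (@exprn_continuous R _ _)).
Qed.

Lemma euclidean_ball_bounded n (r : R) m p (f : 'cV[R]_n -> 'M[R]_(m, p)) :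
  continuous f ->
  exists2 D, 0 <= D & forall v, euclidean_norm v <= r -> `|f v| <= D.
Proof.
move=> fc; have := @euclidean_ball_compact R n r.
move=> /(continuous_compact (continuous_subspaceT fc)) /compact_bounded.
case=> D [_ H]; exists (Num.max (D + 1) 0); first by rewrite le_max lexx orbT.
move=> v vr; apply: H; last by exists v.
by rewrite lt_max ltrDl ltr01.
Qed.

End MatrixContinuity.

Section EncodingContinuity.
Variables (R : realType) (n : nat) (Omega : R) (e : encoding R n).

Lemma cosh_continuous : continuous (@cosh R).
Proof.
move=> x; apply: cvgM; last exact: cvg_cst.
apply: cvgD; first exact: continuous_expR.
apply: (@continuous_comp _ _ _ -%R expR); last exact: continuous_expR.
exact: opp_continuous.
Qed.

Lemma sinh_continuous : continuous (@sinh R).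
Proof.
move=> x; apply: cvgM; last exact: cvg_cst.
apply: cvgB; first exact: continuous_expR.
apply: (@continuous_comp _ _ _ -%R expR); last exact: continuous_expR.
exact: opp_continuous.
Qed.

Lemma ancilla_cov_continuous : continuous (ancilla_cov Omega e).
Proof.
have twoc := continuous_mul_fun (@continuous_const _ R 2) (@squeezing_continuous _ _ e).
have cc := continuous_comp_fun twoc cosh_continuous.
have sc := continuous_comp_fun twoc sinh_continuous.
have cphi := continuous_comp_fun (@squeezing_phase_continuous _ _ e) (@continuous_cos R).
have sphi := continuous_comp_fun (@squeezing_phase_continuous _ _ e) (@continuous_sin R).
apply: continuous_mx => i j.
under eq_fun do rewrite !mxE.
apply: continuous_mul_fun.
  by apply: continuous_add_fun; [exact: n_thermal_continuous|exact: continuous_const].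
case: (i == 0); case: (j == 0).
- apply: continuous_mul_fun; last exact: continuous_const.
  exact: continuous_add_fun cc (continuous_mul_fun cphi sc).
- exact: continuous_mul_fun sphi sc.
- exact: continuous_mul_fun sphi sc.
- apply: continuous_mul_fun; last exact: continuous_const.
  exact: continuous_sub_fun cc (continuous_mul_fun cphi sc).
Qed.

Lemma ancilla_mean_continuous : continuous (ancilla_mean Omega e).
Proof.
have ac := @alpha_abs_continuous _ _ e.
have ca := continuous_comp_fun (@alpha_arg_continuous _ _ e) (@continuous_cos R).
have sa := continuous_comp_fun (@alpha_arg_continuous _ _ e) (@continuous_sin R).
apply: continuous_mx => i j.
under eq_fun do rewrite !mxE.
case: (i == 0); (apply: continuous_mul_fun; last exact: continuous_const).
  exact: continuous_mul_fun ac ca.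
exact: continuous_mul_fun ac sa.
Qed.

End EncodingContinuity.

Lemma trmx_exp (R : comNzRingType) n (A : 'M[R]_n) k : A^T ^+ k = (A ^+ k)^T.
Proof.
elim: k => [|k IH]; first by rewrite !expr0 trmx1.
by rewrite exprS exprSr IH -!mulmxE trmx_mul.
Qed.

Section OutputContinuity.
Variables (R : realType) (n : nat) (M dt : R) (sys : reservoir n dt).

Let A := blockA sys.
Let B := blockB sys.
Let Om := ancilla_frequency sys.
Let d := (nres (net sys)).*2.

Definition mean_term (s : input_seq R n) j :=
  A ^+ j *m B *m ancilla_mean Om (enc sys) (s j).

Definition cov_term (s : input_seq R n) j :=
  A ^+ j *m B *m ancilla_cov Om (enc sys) (s j) *m B^T *m A^T ^+ j.

Lemma mean_term_bound : exists c q, 0 <= q < 1 /\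
  forall j (s : bounded_inputs n M), `|mean_term (val s) j| <= c * q ^+ j.
Proof.
have [c [q [c0 q01 Acq]]] := spectral_radius_decay (spectral_radius_lt1 sys).
have [D D0 Hm] := euclidean_ball_bounded M (@ancilla_mean_continuous _ _ Om (enc sys)).
exists (2%:R * (d%:R * (c * `|B|) * D)), q; split=> // j s.
rewrite (_ : _ * _ ^+ _ = 2%:R * (d%:R * (c * q ^+ j * `|B|) * D)); last by ring.
apply: mx_norm_mulmx_le; last exact: Hm (history_bounded s j).
exact: mx_norm_mulmx_le.
Qed.

Lemma cov_term_bound : exists c q, 0 <= q < 1 /\
  forall j (s : bounded_inputs n M), `|cov_term (val s) j| <= c * q ^+ j.
Proof.
have [c [q [c0 q01 Acq]]] := spectral_radius_decay (spectral_radius_lt1 sys).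
have [D D0 Hm] := euclidean_ball_bounded M (@ancilla_cov_continuous _ _ Om (enc sys)).
have /andP[q0 /ltW q1] := q01.
exists (d%:R * (2%:R * (2%:R * (d%:R * (c * `|B|) * D) * `|B|) * c)), q.
split=> // j s.
rewrite (_ : _ * _ ^+ _ =
  d%:R * (2%:R * (2%:R * (d%:R * (c * q ^+ j * `|B|) * D) * `|B|) * c)); last by ring.
(* The decay of the left power is enough; the right power is merely bounded. The factors 2 and d in
   the constant are inner dimensions of the matrix products. *)
have AT : `|A^T ^+ j| <= c.
  rewrite trmx_exp mx_norm_trmx (le_trans (Acq j)) // ler_piMr //.
  exact: exprn_ile1.
apply: mx_norm_mulmx_le => //.
apply: mx_norm_mulmx_le; last by rewrite mx_norm_trmx.
apply: mx_norm_mulmx_le; last exact: Hm (history_bounded s j).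
exact: mx_norm_mulmx_le.
Qed.

Lemma reservoir_mean_continuous :
  continuous ((fun s : bounded_inputs n M => reservoir_mean sys (val s))
    : history_space n M -> _).
Proof.
have [c [q [q01 H]]] := mean_term_bound.
apply: (@series_geometric_continuous _ _ _ _ q01 (history_space n M)
  (fun j (s : bounded_inputs n M) => mean_term (val s) j)) => // j.
apply: continuous_mulmx; first exact: continuous_const.
move=> s; apply: (@continuous_comp (history_space n M) _ _
  (fun s : bounded_inputs n M => val s j) (ancilla_mean Om (enc sys))).
  exact: history_coord_continuous.
exact: ancilla_mean_continuous.
Qed.

Lemma reservoir_cov_continuous :
  continuous ((fun s : bounded_inputs n M => reservoir_cov sys (val s))
    : history_space n M -> _).
Proof.
have [c [q [q01 H]]] := cov_term_bound.
apply: (@series_geometric_continuous _ _ _ _ q01 (history_space n M)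
  (fun j (s : bounded_inputs n M) => cov_term (val s) j)) => // j.
apply: continuous_mulmx; last exact: continuous_const.
apply: continuous_mulmx; last exact: continuous_const.
apply: continuous_mulmx; first exact: continuous_const.
move=> s; apply: (@continuous_comp (history_space n M) _ _
  (fun s : bounded_inputs n M => val s j) (ancilla_cov Om (enc sys))).
  exact: history_coord_continuous.
exact: ancilla_cov_continuous.
Qed.

Lemma output_continuous :
  continuous ((fun s : bounded_inputs n M => output sys (val s))
    : history_space n M -> R).
Proof.
rewrite /output; case: (readout_of sys) => p /=.
  apply: (@continuous_meval _ (history_space n M) _
    (fun i (s : bounded_inputs n M) => mxvec (reservoir_cov sys (val s)) 0 i)) => i.
  case/mxvec_indexP: i => i j; under eq_fun do rewrite mxvecE.
  exact: (continuous_coord reservoir_cov_continuous).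
apply: (@continuous_meval _ (history_space n M) _
  (fun i (s : bounded_inputs n M) => reservoir_mean sys (val s) i 0)) => i.
exact: (continuous_coord reservoir_mean_continuous).
Qed.

End OutputContinuity.

Lemma Q_fading_memory (R : realType) n (M dt : R) :
  Q n M dt `<=` @fading_memory R n M.
Proof.
move=> F [sys _ FE]; apply: continuous_fading_memory.
by rewrite (_ : F = fun s => output sys (val s)) ?funeqE //; exact: output_continuous.
Qed.

(** * A network of two oscillators *)

Lemma spectral_radius_scalar_lt1 (R : realType) m (a : R) :
  `|a| < 1 -> spectral_radius (a%:M : 'M[R]_m) < 1.
Proof.
move=> a1; rewrite /spectral_radius; set E := (X in sup X).
(* A matrix of size 0 has no eigenvalue, and the supremum of the empty set is 0. *)
have [E0|/set0P/negP] := pselect (E !=set0); last first.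
  by rewrite negbK => /eqP ->; rewrite sup0 ltr01.
apply: le_lt_trans a1; apply: ge_sup => // _ [z + <-].
rewrite /mkset map_scalar_mx => /eigenvalueP[v /eqP]; rewrite mul_mx_scalar.
rewrite -subr_eq0 -scalerBl scaler_eq0 subr_eq0 => /orP[/eqP <- _|/eqP -> /eqP //].
by rewrite normc_real_complex.
Qed.

Lemma val_oscillator m (i : 'I_(m.*2 + 2)) : oscillator i = i./2 :> nat.
Proof. by rewrite /oscillator inordK //; have := ltn_ord i; lia. Qed.

Section TwoModes.
Variables (R : realType) (w : R).
Hypothesis w0 : 0 < w.

(** With P1, P2 the projections onto the two modes, w^2 P1 + 4 w^2 P2 has diagonal 52/25, 73/25 and
    off-diagonal -36/25, in units of w^2. So the coupling is 36/25, and the squared frequencies are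
    52/25 - 36/25 = (4/5)^2 and 73/25 - 36/25 = 37/25. *)
Definition two_mode_frequency (i : 'I_2) : R :=
  if i == 0 then 4 / 5 * w else Num.sqrt 37 / 5 * w.

Definition two_mode_coupling : 'M[R]_2 :=
  \matrix_(i, j) (if i == j then 0 else 36 / 25 * w ^+ 2).

Lemma two_mode_frequency_gt0 i : 0 < two_mode_frequency i.
Proof.
by rewrite /two_mode_frequency; case: ifP => _; rewrite !mulr_gt0 ?invr_gt0.
Qed.

Lemma two_mode_coupling_sym i j : two_mode_coupling i j = two_mode_coupling j i.
Proof. by rewrite !mxE eq_sym. Qed.

Lemma two_mode_coupling_ge0 i j : 0 <= two_mode_coupling i j.
Proof. by rewrite mxE; case: ifP => // _; rewrite mulr_ge0 ?sqr_ge0 // divr_ge0. Qed.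

Lemma two_mode_coupling_diag i : two_mode_coupling i i = 0.
Proof. by rewrite mxE eqxx. Qed.

(* The potential matrix has the eigenvectors (4, 3) / 5 and (3, -4) / 5, with
   normal frequencies [w] and [2 * w]. *)
Definition two_mode_network : harmonic_network R :=
  @HarmonicNetwork R 1 isT two_mode_frequency two_mode_frequency_gt0
    two_mode_coupling two_mode_coupling_sym two_mode_coupling_ge0
    two_mode_coupling_diag.

(** Indices are natural numbers so that entries compute by case analysis, which the [inord] inside
    [oscillator] would block. *)
Definition two_mode_potential (i j : nat) : R :=
  (if i == j then if i == 0%N then 52 else 73 else - 36) / 25 * w ^+ 2.

Lemma potential_two_modeE (i j : 'I_2) :
  potential two_mode_network i j = two_mode_potential i j.
Proof.
rewrite !mxE /= !big_ord_recl big_ord0 !mxE /two_mode_potential.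
have sqE : (Num.sqrt 37 / 5 * w) ^+ 2 = 37 / 25 * w ^+ 2.
  by rewrite !exprMn sqr_sqrtr //; field.
case: i => [[|[|i]] Hi] //; case: j => [[|[|j]] Hj] //=;
  by rewrite /two_mode_frequency /= ?sqE ?mulr1n ?mulr0n /=; field.
Qed.

Definition two_mode_hamilton (i j : nat) : R :=
  if odd i then (if odd j then 0 else - two_mode_potential i./2 j./2)
  else (odd j && (i./2 == j./2))%:R.

Lemma hamilton_two_modeE (i j : 'I_(1.*2 + 2)) :
  hamilton_matrix (potential two_mode_network) i j = two_mode_hamilton i j.
Proof.
rewrite mxE /two_mode_hamilton; case: ifP => _; last first.
  by rewrite -(inj_eq val_inj) /= !val_oscillator.
by case: ifP => // _; rewrite potential_two_modeE !val_oscillator.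
Qed.

(** Orthogonal projection onto the line of (4, 3); [two_mode_proj2] is the one onto the line of (3,
    -4). *)
Definition two_mode_proj1 (i j : nat) : R :=
  (if i == j then if i == 0%N then 16 else 9 else 12) / 25.

Definition two_mode_proj2 (i j : nat) : R :=
  (if i == j then if i == 0%N then 9 else 16 else - 12) / 25.

(** A mode of frequency v evolves by cos (v t), sin (v t) / v, - v sin (v t), cos (v t); the flow is
    the sum of the two mode evolutions, for v = w and v = 2 w, each weighted by its projection. *)
Definition two_mode_flow_entry (t : R) (i j : nat) : R :=
  let p := two_mode_proj1 i./2 j./2 in let q := two_mode_proj2 i./2 j./2 in
  if odd i == odd j then p * cos (w * t) + q * cos (2 * w * t)
  else if odd j then p / w * sin (w * t) + q / (2 * w) * sin (2 * w * t)
  else - (p * w) * sin (w * t) + - (q * (2 * w)) * sin (2 * w * t).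

Definition two_mode_flow (t : R) : 'M[R]_(1.*2 + 2) :=
  \matrix_(i, j) two_mode_flow_entry t i j.

Lemma is_derive_cos_lin (c : R) t :
  is_derive t (1 : R) (fun u => cos (c * u)) (- (c * sin (c * t))).
Proof.
have H : is_derive t (1 : R) (fun u => c * u) c.
  by apply: is_derive_eq; rewrite -[RHS]mulr1.
have := @is_derive1_comp R cos (fun u => c * u) t _ _ (is_derive_cos _) H.
by move=> H2; apply: (is_derive_eq H2); ring.
Qed.

Lemma is_derive_sin_lin (c : R) t :
  is_derive t (1 : R) (fun u => sin (c * u)) (c * cos (c * t)).
Proof.
have H : is_derive t (1 : R) (fun u => c * u) c.
  by apply: is_derive_eq; rewrite -[RHS]mulr1.
have := @is_derive1_comp R sin (fun u => c * u) t _ _ (is_derive_sin _) H.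
by move=> H2; apply: (is_derive_eq H2); ring.
Qed.

Lemma is_derive_lincomb (f g : R -> R) (a b df dg t : R) :
  is_derive t (1 : R) f df -> is_derive t (1 : R) g dg ->
  is_derive t (1 : R) (fun u => a * f u + b * g u) (a * df + b * dg).
Proof.
move=> Hf Hg; exact: (is_deriveD (is_deriveZ a Hf) (is_deriveZ b Hg)).
Qed.

Lemma two_mode_flowP :
  linear_flow (hamilton_matrix (potential two_mode_network)) two_mode_flow.
Proof.
have wn : w != 0 by rewrite gt_eqF.
split.
  apply/matrixP => i j; rewrite !mxE /two_mode_flow_entry !mulr0 cos0 sin0 !mulr0.
  rewrite -(inj_eq val_inj) /two_mode_proj1 /two_mode_proj2.
  by case: i => [[|[|[|[|i]]]] Hi] //; case: j => [[|[|[|[|j]]]] Hj] //=; field.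
move=> t i j.
have -> : (fun u => two_mode_flow u i j) = (fun u => two_mode_flow_entry u i j).
  by apply/funext => u; rewrite mxE.
have -> : (hamilton_matrix (potential two_mode_network) *m two_mode_flow t) i j =
    \sum_(k < 4) two_mode_hamilton i k * two_mode_flow_entry t k j.
  by rewrite mxE; apply: eq_bigr => k _; rewrite hamilton_two_modeE mxE.
rewrite !big_ord_recl big_ord0 /= /two_mode_hamilton /two_mode_flow_entry.
rewrite /two_mode_potential /two_mode_proj1 /two_mode_proj2 /bump /=.
(* Entries between coordinates of the same parity combine cosines, the others sines; each of the
   sixteen cases tries both. *)
case: i => [[|[|[|[|i]]]] Hi] //; case: j => [[|[|[|[|j]]]] Hj] //=;
  (apply: (is_derive_eq (is_derive_lincomb _ _ (is_derive_cos_lin w t)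
     (is_derive_cos_lin (2 * w) t))) ||
   apply: (is_derive_eq (is_derive_lincomb _ _ (is_derive_sin_lin w t)
     (is_derive_sin_lin (2 * w) t)))); by field.
Qed.

End TwoModes.

(** * The two-mode reservoir at time dt *)

Section TwoModeReservoir.
Variables (R : realType) (n : nat) (M dt : R).
Hypothesis dt0 : 0 < dt.

Let w := pi / dt.

Lemma two_mode_rate_gt0 : 0 < w.
Proof. by rewrite divr_gt0 // pi_gt0. Qed.

Let flow := two_mode_flow w.

(** At time dt the phases are pi and 2 pi: the sines vanish, the cosines are -1 and 1, and the flow
    is P2 - P1 on positions and on momenta. *)
Let flow_entry (i j : 'I_(1.*2 + 2)) :
  flow dt i j = if odd i == odd j
    then two_mode_proj2 R i./2 j./2 - two_mode_proj1 R i./2 j./2 else 0.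
Proof.
have dtn : dt != 0 by rewrite gt_eqF.
have E1 : w * dt = pi by rewrite /w divfK.
have E2 : 2 * w * dt = pi *+ 2 by rewrite -mulrA E1 mulr_natl.
rewrite mxE /two_mode_flow_entry E1 E2 cospi sinpi cos2pi sin2pi !mulr0 addr0 mulr1 mulrN1.
by rewrite addrC if_same.
Qed.

Lemma two_mode_blockA : ulsubmx (flow dt) = (- (7 / 25))%:M.
Proof.
apply/matrixP => i j; rewrite [LHS](_ : _ = flow dt (lshift 2 i) (lshift 2 j)).
  rewrite flow_entry mxE /two_mode_proj1 /two_mode_proj2 /=.
  rewrite -(inj_eq val_inj).
  by case: i => [[|[|i]] Hi] //; case: j => [[|[|j]] Hj] //=; field.
by rewrite [LHS]mxE mxE.
Qed.

Lemma two_mode_blockB : ursubmx (flow dt) = (- (24 / 25))%:M.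
Proof.
apply/matrixP => i j; rewrite [LHS](_ : _ = flow dt (lshift 2 i) (rshift 1.*2 j)).
  rewrite flow_entry mxE /two_mode_proj1 /two_mode_proj2 /=.
  rewrite -(inj_eq val_inj).
  by case: i => [[|[|i]] Hi] //; case: j => [[|[|j]] Hj] //=; field.
by rewrite [LHS]mxE mxE.
Qed.

Lemma two_mode_spectral_radius : spectral_radius (ulsubmx (flow dt)) < 1.
Proof.
rewrite two_mode_blockA; apply: spectral_radius_scalar_lt1.
by rewrite normrN ger0_norm; lra.
Qed.

Definition two_mode_reservoir (e : encoding R n) : reservoir n dt :=
  @Reservoir R n dt (two_mode_network two_mode_rate_gt0) flow
    (two_mode_flowP two_mode_rate_gt0) two_mode_spectral_radius e
    (CovReadout (mpoly.mpolyX R (mpoly.mnm1 (mxvec_index ord0 ord0)))).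

Section Output.
Variables (e : encoding R n) (s : bounded_inputs n M).

Let sys := two_mode_reservoir e.
Let cov00 u := ancilla_cov (ancilla_frequency sys) e u 0 0.

Definition two_mode_output_term j : R :=
  (7 / 25) ^+ 2 ^+ j * ((24 / 25) ^+ 2 * cov00 (val s j)).

Lemma two_mode_cov_termE j : cov_term sys (val s) j 0 0 = two_mode_output_term j.
Proof.
rewrite /cov_term.
have -> : blockA sys = (- (7 / 25))%:M by exact: two_mode_blockA.
have -> : blockB sys = (- (24 / 25))%:M by exact: two_mode_blockB.
have powE a : (a%:M : 'M[R]_(1.*2)) ^+ j = (a ^+ j)%:M by rewrite rmorphXn.
rewrite /two_mode_output_term.
have -> : (7 / 25) ^+ 2 ^+ j = (- (7 / 25)) ^+ j * (- (7 / 25)) ^+ j :> R.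
  by rewrite -exprMn mulrNN.
rewrite /cov00 !tr_scalar_mx powE.
move: (ancilla_cov _ _ _) ((- (7 / 25)) ^+ j) (24 / 25) => C a b.
rewrite !mul_mx_scalar -!scalemxAl mul_scalar_mx !scalerA mxE.
by ring.
Qed.

Lemma cvg_two_mode_output : series two_mode_output_term @ \oo --> output sys (val s).
Proof.
have [c [q [q01 H]]] := cov_term_bound M sys.
have cv := cvg_series_geometric q01 (H ^~ s).
have -> : output sys (val s) = reservoir_cov sys (val s) 0 0.
  by rewrite /output /= mpoly.mevalXU mxvecE.
have -> : series two_mode_output_term = fun N => series (cov_term sys (val s)) N 0 0.
  apply/funext => N; rewrite /series /= summxE.
  by apply: eq_bigr => j _; rewrite two_mode_cov_termE.
apply: (@cvg_comp _ _ _ (series (cov_term sys (val s))) (fun A : 'M[R]_(1.*2) => A 0 0) _ _ _ cv).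
exact: coord_continuous.
Qed.

End Output.

End TwoModeReservoir.

(** * Separation and universality *)

(* With ratio below 1/2, the first differing term outweighs the rest. *)
Lemma geometric_series_inj (R : realType) (q delta l : R) (g g' : nat -> R) k :
  0 <= q < 2^-1 -> 0 < delta -> 0 < q ->
  (forall j, (j < k)%N -> g j = g' j) -> `|g k - g' k| = delta ->
  (forall j, `|g j - g' j| <= delta) ->
  series (fun j => q ^+ j * g j) @ \oo --> l ->
  ~ series (fun j => q ^+ j * g' j) @ \oo --> l.
Proof.
move=> /andP[q0 q2] d0 qpos gg' gk gd sg sg'.
have q01 : 0 <= q < 1 by rewrite q0 /=; lra.
pose u j := q ^+ j * (g j - g' j).
have uq j : `|u j| <= delta * q ^+ j.
  by rewrite normrM ger0_norm ?exprn_ge0 // mulrC ler_wpM2r ?exprn_ge0.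
have us : series u = (fun N => series (fun j => q ^+ j * g j) N -
    series (fun j => q ^+ j * g' j) N).
  apply/funext => N; rewrite /series /= -sumrB; apply: eq_bigr => j _.
  by rewrite /u mulrBr.
(* If both series converged to l, the differences would sum to 0 and term k would be minus the tail
   from k + 1 on. Then q ^ k delta <= delta q ^ (k + 1) / (1 - q), against 1 - 2 q > 0. *)
have u0 : limn (series u) = 0.
  by apply: cvg_lim => //; rewrite us -(subrr l); exact: cvgB.
have := series_geometric_tail q01 uq k.+1.
have -> : series u k.+1 = u k.
  rewrite seriesSr /series /= big1_seq ?add0r // => j /andP[_].
  by rewrite mem_index_iota => /andP[_ jk]; rewrite /u gg' // subrr mulr0.
rewrite u0 sub0r normrN /u normrM gk ger0_norm ?exprn_ge0 //.
rewrite ler_pdivlMr; last by lra.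
have : 0 < q ^+ k * delta * (1 - q - q).
  by rewrite !mulr_gt0 ?exprn_gt0 //; lra.
by rewrite exprS; lra.
Qed.

Section Ramp.
Variables (R : realType) (a b : R).

(** The cosine shape suits all three encodings: it is continuous with values in [0, 1], and taking
    its angle as squeezing phase makes the variance affine in the ramp. *)
Definition ramp (x : R) : R := (1 - cos (pi * ((x - a) / (b - a)))) / 2.

Lemma ramp_itv x : 0 <= ramp x <= 1.
Proof.
rewrite /ramp; set c := cos _.
by have := cos_geN1 (pi * ((x - a) / (b - a))); have := cos_le1 (pi * ((x - a) / (b - a)));
  rewrite -/c; lra.
Qed.

Lemma ramp_left : ramp a = 0.
Proof. by rewrite /ramp subrr mul0r mulr0 cos0 subrr mul0r. Qed.

Lemma ramp_right : a != b -> ramp b = 1.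
Proof.
move=> ab; rewrite /ramp divff ?mulr1 ?cospi; first by field.
by rewrite subr_eq0 eq_sym.
Qed.

Lemma ramp_angle_continuous : continuous (fun x => pi * ((x - a) / (b - a)) : R).
Proof.
apply: continuous_mul_fun; first exact: continuous_const.
apply: continuous_mul_fun; last exact: continuous_const.
apply: continuous_sub_fun; last exact: continuous_const.
by move=> x; exact: cvg_id.
Qed.

Lemma ramp_continuous : continuous ramp.
Proof.
apply: continuous_mul_fun; last exact: continuous_const.
apply: continuous_sub_fun; first exact: continuous_const.
exact: continuous_comp_fun ramp_angle_continuous (@continuous_cos R).
Qed.

End Ramp.

Section Separation.
Variables (R : realType) (n : nat) (M dt : R).
Hypothesis dt0 : 0 < dt.
Implicit Types s : bounded_inputs n M.

Definition linear_form (v u : 'cV[R]_n) : R := (v^T *m u) 0 0.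

Lemma linear_form_continuous v : continuous (linear_form v).
Proof.
apply: continuous_coord; apply: continuous_mulmx; first exact: continuous_const.
by move=> u; exact: cvg_id.
Qed.

Lemma linear_encoding_continuous v (f : R -> R) : continuous f ->
  continuous (fun u => f (linear_form v u)).
Proof. exact: continuous_comp_fun (@linear_form_continuous v). Qed.

Lemma first_difference s s' : s <> s' ->
  exists k v, (forall j, (j < k)%N -> val s j = val s' j) /\
    linear_form v (val s k) != linear_form v (val s' k).
Proof.
move=> ss'; have ex : exists k, val s k != val s' k.
  apply: contrapT => H; apply: ss'; apply: val_inj; apply/funext => k.
  by apply/eqP; apply: contrapT => /negP Hk; apply: H; exists k.
have [k sk kmin] := ex_minnP ex; exists k.
have [i si] : exists i, val s k i 0 != val s' k i 0.
  apply: contrapT => H; move/eqP: sk; apply; apply/colP => i.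
  by apply/eqP; apply: contrapT => /negP Hi; apply: H; exists i.
exists (delta_mx i 0); split=> [j jk|].
  by apply/eqP; apply: contraTT jk => /kmin; rewrite -leqNgt.
by rewrite /linear_form trmx_delta -!rowE !mxE.
Qed.

(** The common core of the three encodings. The ramp is 0 at the input of s at index k and 1 at that
    of s', so the variances there differ by |c|, the largest difference possible at any index. *)
Lemma two_mode_separation (e : encoding R n) s s' k v (c d : R) :
  let r := ramp (linear_form v (val s k)) (linear_form v (val s' k)) in
  let sys := two_mode_reservoir dt0 e in
  (forall j, (j < k)%N -> val s j = val s' j) ->
  linear_form v (val s k) != linear_form v (val s' k) -> c != 0 ->
  (forall u, ancilla_cov (ancilla_frequency sys) e u 0 0 =
    c * r (linear_form v u) + d) ->
  output sys (val s) <> output sys (val s').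
Proof.
move=> r sys ss' ab c0 covE.
have b0 : 0 < (24 / 25) ^+ 2 :> R by rewrite expr2; lra.
have q0 : 0 < (7 / 25) ^+ 2 :> R by rewrite expr2; lra.
have q01 : 0 <= (7 / 25 : R) ^+ 2 < 2^-1 by rewrite (ltW q0) expr2; lra.
have r01 u u' : `|r u - r u'| <= 1.
  have /andP[? ?] : 0 <= r u <= 1 := ramp_itv _ _ _.
  have /andP[? ?] : 0 <= r u' <= 1 := ramp_itv _ _ _.
  by rewrite ler_norml; lra.
have rk : `|r (linear_form v (val s k)) - r (linear_form v (val s' k))| = 1.
  by rewrite /r ramp_left ramp_right // sub0r normrN normr1.
have covB u u' : `|(24 / 25) ^+ 2 * ancilla_cov (ancilla_frequency sys) e u 0 0 -
    (24 / 25) ^+ 2 * ancilla_cov (ancilla_frequency sys) e u' 0 0| =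
    (24 / 25) ^+ 2 * `|c| * `|r (linear_form v u) - r (linear_form v u')|.
  rewrite !covE -mulrBr normrM (gtr0_norm b0) opprD addrACA subrr addr0.
  by rewrite -mulrBr normrM mulrA.
pose g (t : bounded_inputs n M) j : R :=
  (24 / 25) ^+ 2 * ancilla_cov (ancilla_frequency sys) e (val t j) 0 0.
have d0 : 0 < (24 / 25) ^+ 2 * `|c| by rewrite (mulr_gt0 b0) // normr_gt0.
have gs j : (j < k)%N -> g s j = g s' j by move=> jk; rewrite /g ss'.
have gk : `|g s k - g s' k| = (24 / 25) ^+ 2 * `|c| by rewrite covB rk mulr1.
have gd j : `|g s j - g s' j| <= (24 / 25) ^+ 2 * `|c|.
  by rewrite covB; exact: ler_piMr (ltW d0) (r01 _ _).
have ls := @cvg_two_mode_output R n M dt dt0 e s.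
have ls' := @cvg_two_mode_output R n M dt dt0 e s'.
move=> outE; rewrite -/sys -outE in ls'.
exact: (geometric_series_inj q01 d0 q0 gs gk gd ls ls').
Qed.

Let Om : R := Num.sqrt 37 / 5 * (pi / dt).

Let Om_gt0 : 0 < Om.
Proof. by rewrite !mulr_gt0 ?invr_gt0 ?pi_gt0 // sqrtr_gt0. Qed.

Let OmE (e : encoding R n) : ancilla_frequency (two_mode_reservoir dt0 e) = Om.
Proof. by []. Qed.

Definition thermal_encoding (f : R -> R) v (fc : continuous f) (f0 : forall x, 0 <= f x) :
  encoding R n :=
  @Encoding R n (fun u => f (linear_form v u)) (fun=> 0) (fun=> 0) (fun=> 0)
    (fun=> 0) (@linear_encoding_continuous v f fc) (@continuous_const _ R 0)
    (@continuous_const _ R 0) (@continuous_const _ R 0) (@continuous_const _ R 0)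
    (fun u => f0 _) (fun=> lexx (0 : R)).

Definition squeezed_encoding (f : R -> R) v (fc : continuous f) : encoding R n :=
  @Encoding R n (fun=> 0) (fun u => f (linear_form v u)) (fun=> 0) (fun=> 0)
    (fun=> 0) (@continuous_const _ R 0) (@linear_encoding_continuous v f fc)
    (@continuous_const _ R 0) (@continuous_const _ R 0) (@continuous_const _ R 0)
    (fun=> lexx (0 : R)) (fun=> lexx (0 : R)).

Definition phase_encoding (f : R -> R) v (fc : continuous f) : encoding R n :=
  @Encoding R n (fun=> 0) (fun=> 1) (fun u => f (linear_form v u)) (fun=> 0)
    (fun=> 0) (@continuous_const _ R 0) (@continuous_const _ R 1)
    (@linear_encoding_continuous v f fc) (@continuous_const _ R 0) (@continuous_const _ R 0)
    (fun=> lexx (0 : R)) (fun=> lexx (0 : R)).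

Lemma cosh0 : cosh 0 = 1 :> R.
Proof. by rewrite /cosh oppr0 expR0; field. Qed.

Lemma sinh0 : sinh 0 = 0 :> R.
Proof. by rewrite /sinh oppr0 subrr mul0r. Qed.

Lemma cosh_sinhD (x : R) : cosh x + sinh x = expR x.
Proof. by rewrite /cosh /sinh; field. Qed.

Lemma Q_thermal_separates s s' : s <> s' ->
  exists2 F, Q_thermal n M dt F & F s <> F s'.
Proof.
move=> /first_difference[k [v [ss' ab]]].
set r := ramp (linear_form v (val s k)) (linear_form v (val s' k)).
have rc : continuous r := @ramp_continuous _ _ _.
have r0 x : 0 <= r x.
  by case/andP: (ramp_itv (linear_form v (val s k)) (linear_form v (val s' k)) x).
pose e := thermal_encoding v rc r0.
exists (fun s => output (two_mode_reservoir dt0 e) (val s)).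
  exists (two_mode_reservoir dt0 e) => //; split=> //; first by eexists.
  by exists r; split=> //; exists v.
(* Without squeezing the position variance is (n_th + 1/2) / Om. *)
apply: (@two_mode_separation e s s' k v Om^-1 (2^-1 * Om^-1)) => // [|u].
  by rewrite invr_eq0 gt_eqF.
rewrite OmE mxE mxE /= mulr0 cosh0 sinh0 mulr0 addr0 mul1r.
rewrite -[ramp _ _ _]/(r (linear_form v u)).
by move: (r _) (Om^-1) => x y; ring.
Qed.

Lemma Q_squeezed_separates s s' : s <> s' ->
  exists2 F, Q_squeezed n M dt F & F s <> F s'.
Proof.
move=> /first_difference[k [v [ss' ab]]].
set r := ramp (linear_form v (val s k)) (linear_form v (val s' k)).
have rc : continuous r := @ramp_continuous _ _ _.
have r1 x : 0 < 1 + r x.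
  have /andP[] := ramp_itv (linear_form v (val s k)) (linear_form v (val s' k)) x.
  by rewrite -/r; lra.
(* At phase 0 the position variance is exp (2 r) / (2 Om) for squeezing strength r; the logarithm
   turns it into (1 + ramp) / (2 Om). *)
pose f x := ln (1 + r x) / 2.
have fc : continuous f.
  apply: continuous_mul_fun; last exact: continuous_const.
  move=> x; apply: (@continuous_comp _ _ _ (fun x => 1 + r x) (@ln R)).
    exact: (continuous_add_fun (@continuous_const _ R 1) rc).
  exact: continuous_ln.
pose e := squeezed_encoding v fc.
exists (fun s => output (two_mode_reservoir dt0 e) (val s)).
  exists (two_mode_reservoir dt0 e) => //; split=> //; first by eexists.
  by exists f; split=> //; [exists v|exists 0].
apply: (@two_mode_separation e s s' k v (2^-1 * Om^-1) (2^-1 * Om^-1)) => // [|u].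
  by rewrite mulf_neq0 ?invr_eq0 ?gt_eqF.
have fE : 2 * f (linear_form v u) = ln (1 + r (linear_form v u)).
  by rewrite mulrC divfK.
rewrite OmE mxE mxE /= cos0 add0r mul1r cosh_sinhD fE lnK ?posrE //.
rewrite -[ramp _ _ _]/(r (linear_form v u)).
by move: (r _) (Om^-1) => x y; ring.
Qed.

Lemma Q_phase_separates s s' : s <> s' ->
  exists2 F, Q_phase n M dt F & F s <> F s'.
Proof.
move=> /first_difference[k [v [ss' ab]]].
set a := linear_form v (val s k) in ab *; set b := linear_form v (val s' k) in ab *.
have sinh2 : 0 < sinh 2 :> R by rewrite divr_gt0 // subr_gt0 ltr_expR; lra.
have fc := @ramp_angle_continuous R a b.
pose e := phase_encoding v fc.
exists (fun s => output (two_mode_reservoir dt0 e) (val s)).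
  exists (two_mode_reservoir dt0 e) => //; split=> //; first by eexists.
  by eexists; split; [exact: fc|exists v|by []|exists 1].
(* For strength 1 the variance is (cosh 2 + cos phi sinh 2) / (2 Om), and cos phi = 1 - 2 ramp. *)
apply: (@two_mode_separation e s s' k v (- (sinh 2 * Om^-1))
  (2^-1 * (cosh 2 + sinh 2) * Om^-1)) => // [|u].
  by rewrite oppr_eq0 mulf_neq0 ?invr_eq0 ?gt_eqF.
rewrite OmE mxE mxE /= mulr1 -/a -/b /ramp.
by move: (cos _) (cosh _) (sinh _) (Om^-1) => x y z t; field.
Qed.

End Separation.

(** * The polynomial algebra generated by a family *)

Import (canonicals) mpoly.

Section PolyAlgebra.
Variables (R : realType) (n : nat) (M : R) (Fam : set (functional n M)).

Lemma poly_algebra_generator F : Fam F -> poly_algebra Fam F.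
Proof.
move=> FamF; exists 1, (fun=> F), (mpoly.mpolyX R (mpoly.mnm1 ord0)).
by split=> // s; rewrite mpoly.mevalXU.
Qed.

(* Both polynomials are rewritten in the disjoint union of their variables. *)
Lemma poly_algebra_common G G' : poly_algebra Fam G -> poly_algebra Fam G' ->
  exists k (Fs : 'I_k -> functional n M) (p p' : mpolynomial R k),
    [/\ forall i, Fam (Fs i), forall s, G s = mpoly.meval (fun i => Fs i s) p &
        forall s, G' s = mpoly.meval (fun i => Fs i s) p'].
Proof.
move=> [k [Fs [p [FamF GE]]]] [k' [Fs' [p' [FamF' GE']]]].
pose H i := match fintype.split i with inl j => Fs j | inr j => Fs' j end.
exists (k + k')%N, H,
  (mpoly.comp_mpoly [tuple mpoly.mpolyX R (mpoly.mnm1 (lshift k' i)) | i < k] p),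
  (mpoly.comp_mpoly [tuple mpoly.mpolyX R (mpoly.mnm1 (rshift k i)) | i < k'] p').
split=> [i|s|s]; first by rewrite /H; case: fintype.split.
- rewrite GE mpoly.comp_mpoly_meval; apply: mpoly.meval_eq => i.
  by rewrite tnth_mktuple mpoly.mevalXU /H (unsplitK (inl i)).
- rewrite GE' mpoly.comp_mpoly_meval; apply: mpoly.meval_eq => i.
  by rewrite tnth_mktuple mpoly.mevalXU /H (unsplitK (inr i)).
Qed.

Lemma poly_algebra_subalgebra :
  subalgebra (poly_algebra Fam : set (history_space n M -> R)).
Proof.
split=> [c|G G' /poly_algebra_common H /H|G G' /poly_algebra_common H /H].
- exists 0%N, (fun=> fun=> 0), (mpoly.mpolyC 0 c).
  by split=> [[]//|s]; rewrite mpoly.mevalC.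
- move=> [k [Fs [p [p' [FamF GE GE']]]]]; exists k, Fs, (p + p').
  by split=> // s; rewrite mpoly.mevalD GE GE'.
- move=> [k [Fs [p [p' [FamF GE GE']]]]]; exists k, Fs, (p * p').
  by split=> // s; rewrite mpoly.mevalM GE GE'.
Qed.

Lemma poly_algebra_continuous (G : functional n M) :
  Fam `<=` @fading_memory R n M -> poly_algebra Fam G ->
  continuous (G : history_space n M -> R).
Proof.
move=> FamC [k [Fs [p [FamF GE]]]].
rewrite (_ : G = fun s => mpoly.meval (fun i => Fs i s) p); last exact/funext.
apply: (@continuous_meval R (history_space n M)) => i.
exact/fading_memory_continuous/FamC.
Qed.

Lemma poly_algebra_universal :
  Fam `<=` @fading_memory R n M ->
  (forall s s' : bounded_inputs n M, s <> s' ->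
    exists2 F, Fam F & F s <> F s') ->
  forall F : functional n M, fading_memory F -> forall e, 0 < e ->
  exists2 G, poly_algebra Fam G &
    (ereal_sup [set (`|F s - G s|)%:E | s in [set: bounded_inputs n M]]
      < e%:E)%E.
Proof.
move=> FamC sep F Fc e e0.
have [||G AG FG] := @stone_weierstrass R (history_space n M) (poly_algebra Fam)
    (@history_space_compact R n M) poly_algebra_subalgebra
    (fun G => @poly_algebra_continuous G FamC) _ F
    (fading_memory_continuous Fc) (e / 2).
- by move=> s s' /sep[G FamG Gs]; exists G => //; exact: poly_algebra_generator.
- by rewrite divr_gt0.
(* Pointwise strict bounds give only a weak bound on the supremum, hence the approximation within e
   / 2. *)
exists G => //; apply: (@le_lt_trans _ _ (e / 2)%:E); last by rewrite lte_fin; lra.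
by apply: ge_ereal_sup => _ [s _ <-]; rewrite lee_fin ltW.
Qed.

End PolyAlgebra.

Theorem mainTheorem2 (R : realType) (n : nat) (M dt : R)
    (n_ge1 : (1 <= n)%N) (M_gt0 : 0 < M) (dt_gt0 : 0 < dt) :
  Q n M dt `<=` @fading_memory R n M /\
  forall Fam : set (functional n M),
    [\/ Fam = Q n M dt, Fam = Q_thermal n M dt,
        Fam = Q_squeezed n M dt | Fam = Q_phase n M dt] ->
    (forall s s' : bounded_inputs n M, s <> s' ->
       exists2 G : functional n M, poly_algebra Fam G & G s <> G s') /\
    (forall F : functional n M, fading_memory F ->
       forall e : R, 0 < e ->
       exists2 G : functional n M, poly_algebra Fam G &
         (ereal_sup [set (`|F s - G s|)%:E | s in [set: bounded_inputs n M]]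
            < e%:E)%E).
Proof.
split=> [|Fam HFam]; first exact: Q_fading_memory.
have FamQ : Fam `<=` Q n M dt.
  by case: HFam => -> // F [sys _ FE]; exists sys.
(* The full family is separated by its thermal members. *)
have sep (s s' : bounded_inputs n M) : s <> s' -> exists2 F, Fam F & F s <> F s'.
  move=> ss'; case: HFam => ->.
  - have [F [sys _ FE] Fs] := Q_thermal_separates dt_gt0 ss'.
    by exists F => //; exists sys.
  - exact: Q_thermal_separates.
  - exact: Q_squeezed_separates.
  - exact: Q_phase_separates.
split=> [s s' /sep[F FamF Fs]|].
  by exists F => //; exact: poly_algebra_generator.
by apply: poly_algebra_universal sep; exact: subset_trans FamQ (@Q_fading_memory _ _ _ _).
Qed.
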